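(* Let $a,b,c,d,e$ be complex numbers such that $e\notin\{0,-1,-2,\ldots\}$ and such that none of $$1+a-b,\quad 1+a-c,\quad 1+a-d,\quad \tfrac12+\tfrac12 a,\quad 1+\tfrac12 a$$ is a non-positive integer, so that all the hypergeometric series below are defined. Suppose that $$\Re(a-c-d)>\max\{-1,\ \Re(b)-\tfrac32\}.$$ Then $${}_5F_4\left[\begin{array}{c}a,\ b,\ c,\ d,\ 1+e\\ 1+a-b,\ 1+a-c,\ 1+a-d,\ e\end{array};-1\right]$$ $$=\frac{\Gamma(1+a-c)\,\Gamma(1+a-d)}{\Gamma(1+a)\,\Gamma(1+a-c-d)}\left\{\frac{a}{2e}\;{}_3F_2\left[\begin{array}{c}c,\ d,\ \tfrac12+\tfrac12a-b\\ \tfrac12+\tfrac12a,\ 1+a-b\end{array};1\right]+\left(1-\frac{a}{2e}\right)\,{}_3F_2\left[\begin{array}{c}c,\ d,\ 1+\tfrac12a-b\\ 1+\tfrac12a,\ 1+a-b\end{array};1\right]\right\}.$$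
   Context: $\Gamma$ denotes the Gamma function and $\Re$ the real part. The Pochhammer symbol is $(\alpha)_0=1$ and $(\alpha)_n=\alpha(\alpha+1)\cdots(\alpha+n-1)$ for $n\ge 1$. The generalized hypergeometric series is $${}_pF_q\left[\begin{array}{c}a_1,\ldots,a_p\\ b_1,\ldots,b_q\end{array};z\right]=\sum_{n=0}^\infty\frac{(a_1)_n\cdots(a_p)_n}{(b_1)_n\cdots(b_q)_n}\,\frac{z^n}{n!},$$ where no denominator parameter $b_j$ is a non-positive integer. For $p=q+1$ and $z=\pm1$, the value is the sum of this series (the limit of its partial sums) when it converges. With parametric excess $s=\sum_j b_j-\sum_j a_j$, the series converges at $z=1$ if $\Re(s)>0$ and at $z=-1$ if $\Re(s)>-1$ (in the latter case the convergence may be only conditional). *)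

(* Defs.v *)
(* Stdlib real numbers with Coquelicot (complex numbers, limits, series). *)
From Stdlib Require Export Reals Factorial List.
From Coquelicot Require Export Coquelicot.
Export ListNotations.

Open Scope R_scope.
Open Scope C_scope.

Definition nonpos_int (z : C) : Prop := exists n : nat, z = - INR n.

Fixpoint poch (z : C) (n : nat) : C :=
  match n with
  | O => 1
  | S m => poch z m * (z + INR m)
  end.

(* Coquelicot's [Lim_seq] and [Series] are real-valued operators; their complex
   versions are taken componentwise.  The value is meaningful only if the
   sequence (series) converges in [C]. *)
Definition CLim_seq (u : nat -> C) : C :=
  (real (Lim_seq (fun n => Re (u n))), real (Lim_seq (fun n => Im (u n)))).

Definition CSeries (u : nat -> C) : C :=
  (Series (fun n => Re (u n)), Series (fun n => Im (u n))).

(* [RCpower x z] is x^z = exp (z ln x), for a real base x > 0. *)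
Definition RCpower (x : R) (z : C) : C :=
  RtoC (exp (Re z * ln x)) * (cos (Im z * ln x), sin (Im z * ln x)).

(* The Euler-Gauss definition of the Gamma function,
     Gamma(z) = lim_(k -> oo) k! k^(z-1) / (z)_k,
   valid for every complex z that is not a non-positive integer. *)
Definition Gamma (z : C) : C :=
  CLim_seq (fun k => INR (fact k) * RCpower (INR k) (z - 1) / poch z k).

Definition Cprod (l : list C) : C := fold_right Cmult (RtoC 1) l.

(* Terms and sum of pFq[a; b; z], where p and q are the lengths of the parameter
   lists.  No entry of [b] may be a non-positive integer: division by zero is
   total in [C]. *)
Definition hyp_term (a b : list C) (z : C) (n : nat) : C :=
  Cprod (map (fun x => poch x n) a) / Cprod (map (fun x => poch x n) b)
  * (z ^ n / INR (fact n)).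

Definition hyp (a b : list C) (z : C) : C := CSeries (hyp_term a b z).

(* Convergence of the partial sums, not necessarily absolute. *)
Definition hyp_cv (a b : list C) (z : C) : Prop :=
  @ex_series C_AbsRing C_NormedModule (hyp_term a b z).

(* Main.v *)
(* For integer m, Bailey's transform (Pfaff-Saalschuetz for one inner sum, a
   terminating well-poised sum for the other) gives the identity
     sum_n t_n w_(m,n) = P_m * sum_k (alpha s_k + beta s'_k) v_(m,k),
   where t, s, s' are the terms of the three series,
     w_(m,n) = (-1)^n (-m)_n / (1+a+m)_n,   v_(m,k) = (-m)_k / (c+d-a-m)_k,
   and P_m is a quotient of Pochhammer symbols.  As m -> oo, P_m tends to the
   Gamma quotient.  The weights w_(m,n) tend to 1 and have essentially
   decreasing modulus in n, so by Abel summation the left side tends to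
   sum_n t_n even when the convergence is only conditional.  On the right one
   has dominated convergence, from (z)_k / k! ~ k^(z-1) / Gamma(z). *)

Require Import Defs.
From Stdlib Require Import Lra Lia.

(** * Finite sums and terminating identities *)


(** The parameter e enters only through (1+e)_n / (e)_n = (e+n)/e = (a+2n)/(2e) + (1 - a/(2e)). This
    splits the left side into a very-well-poised sum with factor a+2n and a well-poised sum with
    factor 1, which is where the two series on the right and the coefficients alpha = a/(2e), beta =
    1 - a/(2e) come from. The two cases share one proof, with an abstract factor [W] and a parameter
    [x], equal to 1/2+a/2 and 1+a/2 respectively.

    The obstacle is the interchange of summations, since the left series may converge only
    conditionally. With the additional parameter -m every double sum is finite, and all analysis is
    moved into the single limit m -> oo. Both series on the right have excess s = 1+a-c-d, so the
    first bound in the hypothesis says Re s > 0; the second says that the excess of the left series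
    has real part above -1. *)

Fixpoint csum (f : nat -> C) (n : nat) : C :=
  match n with
  | O => 0
  | S m => csum f m + f m
  end.

Lemma csum_ext f g n :
  (forall i, (i < n)%nat -> f i = g i) -> csum f n = csum g n.
Proof.
  induction n as [|n IH]; intros H; simpl; [easy|].
  rewrite IH by (intros; apply H; lia). now rewrite H by lia.
Qed.

Lemma csum_plus f g n :
  csum (fun i => f i + g i) n = csum f n + csum g n.
Proof. induction n as [|n IH]; simpl; [ring|rewrite IH; ring]. Qed.

Lemma csum_scal c f n : csum (fun i => c * f i) n = c * csum f n.
Proof. induction n as [|n IH]; simpl; [ring|rewrite IH; ring]. Qed.

Lemma csum_Sl f n : csum f (S n) = f O + csum (fun i => f (S i)) n.
Proof.
  induction n as [|n IH]; [simpl; ring|].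
  replace (csum f (S (S n))) with (csum f (S n) + f (S n)) by reflexivity.
  rewrite IH; simpl; ring.
Qed.

Lemma csum_telescope g n : csum (fun i => g (S i) - g i) n = g n - g O.
Proof. induction n as [|n IH]; simpl; [ring|rewrite IH; ring]. Qed.

(** The interchange of summation in Bailey's transform, with k = n + j. *)
Lemma csum_triangle (f : nat -> nat -> C) N :
  csum (fun k => csum (fun n => f k n) (S k)) N =
  csum (fun n => csum (fun j => f (n + j)%nat n) (N - n)) N.
Proof.
  induction N as [|N IH]; [easy|].
  replace (csum (fun k => csum (fun n => f k n) (S k)) (S N))
    with (csum (fun k => csum (fun n => f k n) (S k)) N
          + csum (fun n => f N n) (S N)) by reflexivity.
  rewrite IH.
  transitivity (csum (fun n => csum (fun j => f (n + j)%nat n) (N - n) + f N n)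
                  (S N)).
  - rewrite csum_plus.
    change (csum (fun n => csum (fun j => f (n + j)%nat n) (N - n)) (S N))
      with (csum (fun n => csum (fun j => f (n + j)%nat n) (N - n)) N
            + csum (fun j => f (N + j)%nat N) (N - N)).
    rewrite Nat.sub_diag; change (csum (fun j => f (N + j)%nat N) 0) with (RtoC 0).
    now rewrite Cplus_0_r.
  - apply csum_ext; intros n Hn.
    replace (S N - n)%nat with (S (N - n)) by lia; simpl.
    now replace (n + (N - n))%nat with N by lia.
Qed.

Lemma INR_S n : RtoC (INR (S n)) = INR n + 1.
Proof. now rewrite S_INR, RtoC_plus. Qed.

Lemma INR_neq n : n <> O -> RtoC (INR n) <> 0.
Proof. intros H E; apply RtoC_inj in E; now apply (not_0_INR n). Qed.

Lemma poch_Sl z n : poch z (S n) = z * poch (z + 1) n.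
Proof.
  induction n as [|n IH]; [simpl; ring|].
  replace (poch z (S (S n))) with (poch z (S n) * (z + INR (S n)))
    by reflexivity.
  rewrite IH; simpl poch; rewrite INR_S; ring.
Qed.

Lemma poch_add z n m : poch z (n + m) = poch z n * poch (z + INR n) m.
Proof.
  induction m as [|m IH]; [rewrite Nat.add_0_r; simpl; ring|].
  rewrite Nat.add_succ_r; simpl; rewrite IH, plus_INR, RtoC_plus; ring.
Qed.

Lemma nonpos_shift z n : ~ nonpos_int z -> ~ nonpos_int (z + INR n).
Proof.
  intros H [k Hk]; apply H; exists (n + k)%nat.
  rewrite plus_INR, RtoC_plus.
  transitivity (z + INR n - INR n); [ring|rewrite Hk; ring].
Qed.

Lemma nonpos_neq0 z : ~ nonpos_int z -> z <> 0.
Proof. intros H E; apply H; exists O; rewrite E; simpl; ring. Qed.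

Lemma nonpos_shift_neq0 z n : ~ nonpos_int z -> z + INR n <> 0.
Proof. intros H; apply nonpos_neq0, nonpos_shift, H. Qed.

Lemma poch_neq0 z n : ~ nonpos_int z -> poch z n <> 0.
Proof.
  intros H; induction n as [|n IH]; simpl.
  - intros E; apply RtoC_inj in E; lra.
  - apply Cmult_neq_0; [easy|now apply nonpos_shift_neq0].
Qed.

Lemma nonpos_1 : ~ nonpos_int 1.
Proof.
  intros [n H]. rewrite <- RtoC_opp in H; apply RtoC_inj in H.
  generalize (pos_INR n); lra.
Qed.

Lemma poch_1 n : poch 1 n = INR (fact n).
Proof.
  induction n as [|n IH]; [reflexivity|].
  simpl poch; rewrite IH.
  replace (fact (S n)) with (S n * fact n)%nat by reflexivity.
  rewrite mult_INR, RtoC_mult, INR_S; ring.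
Qed.

(** This compares coefficients of x^N in Euler's transformation (1-x)^(-s) 2F1[A,B;D;x] =
    2F1[D-A,D-B;D;x]. The convolution form keeps the parameter 1-s-N of the usual 3F2 out of the
    denominator. The proof is by a first-order recurrence in N. *)
Lemma Pfaff_Saalschutz A B D s N :
  s = D - A - B -> ~ nonpos_int D ->
  csum (fun k => poch A k * poch B k * poch s (N - k) /
                 (poch 1 k * poch 1 (N - k) * poch D k)) (S N) =
  poch (D - A) N * poch (D - B) N / (poch 1 N * poch D N).
Proof.
  intros Hs HD; pose proof nonpos_1 as H1.
  induction N as [|N IH].
  { simpl; field. }
  set (F := fun N k => poch A k * poch B k * poch s (N - k) /
                 (poch 1 k * poch 1 (N - k) * poch D k)) in *.
  fold (F N) in IH; fold (F (S N)).
  (* Zeilberger's method: [g] is the certificate that makes the recurrence in N telescope over k <=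
     N, and g 0 = 0. *)
  set (g := fun k => - (INR k * (D + INR k - 1) * F (S N) k)).
  assert (HN := nonpos_shift_neq0 D N HD).
  assert (HN1 := INR_neq (S N) (Nat.neq_succ_0 N)).
  assert (E : INR (S N) * (D + INR N) * csum (F (S N)) (S N)
          - (D - A + INR N) * (D - B + INR N) * csum (F N) (S N) = g (S N)).
  { transitivity (csum (fun k => g (S k) - g k) (S N)).
    2:{ rewrite csum_telescope; unfold g; simpl INR; ring. }
    rewrite <- !csum_scal. unfold Cminus at 1.
    replace (- csum (fun i => (D - A + INR N) * (D - B + INR N) * F N i) (S N))
      with (csum (fun i => (-1) * ((D - A + INR N) * (D - B + INR N) * F N i))
              (S N)) by (rewrite csum_scal; ring).
    rewrite <- csum_plus. apply csum_ext; intros k Hk.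
    destruct (Nat.le_exists_sub k N) as [j [-> _]]; [lia|].
    unfold g, F.
    replace (S (j + k) - S k)%nat with j by lia.
    replace (S (j + k) - k)%nat with (S j) by lia.
    replace (j + k - k)%nat with j by lia.
    simpl poch; rewrite !INR_S, plus_INR, RtoC_plus, Hs.
    assert (P1 := poch_neq0 1 j H1). assert (P2 := poch_neq0 1 k H1).
    assert (P3 := poch_neq0 D k HD). assert (P4 := nonpos_shift_neq0 D k HD).
    assert (P5 := nonpos_shift_neq0 1 j H1).
    assert (P6 := nonpos_shift_neq0 1 k H1).
    field; auto 10. }
  rewrite IH in E.
  (* The term k = N+1 lies outside the telescoped range; multiplied by (N+1)(D+N) it is exactly - g
     (N+1). *)
  change (csum (F (S N)) (S (S N))) with (csum (F (S N)) (S N) + F (S N) (S N)).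
  assert (E2 : INR (S N) * (D + INR N) * (csum (F (S N)) (S N) + F (S N) (S N))
     = (D - A + INR N) * (D - B + INR N) *
       (poch (D - A) N * poch (D - B) N / (poch 1 N * poch D N))).
  { rewrite Cmult_plus_distr_l.
    replace (INR (S N) * (D + INR N) * csum (F (S N)) (S N)) with
      (g (S N) + (D - A + INR N) * (D - B + INR N) *
       (poch (D - A) N * poch (D - B) N / (poch 1 N * poch D N)))
      by (rewrite <- E; ring).
    unfold g; rewrite !INR_S; ring. }
  transitivity (INR (S N) * (D + INR N) * (csum (F (S N)) (S N) + F (S N) (S N))
     / (INR (S N) * (D + INR N))).
  { field; auto. }
  rewrite E2; simpl poch; rewrite INR_S.
  assert (P1 := poch_neq0 1 N H1). assert (P3 := poch_neq0 D N HD).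
  assert (P5 := nonpos_shift_neq0 1 N H1). rewrite INR_S in HN1.
  field; auto.
Qed.

(* The factor [W a n] is used as 1 and as [a + 2 n]; the relation
   W a (n+1) = W (a+2) n is all that the recursion below needs of it. *)
Definition wp_term (W : C -> nat -> C) (k : nat) (a b : C) (n : nat) : C :=
  W a n * (poch a n * poch b n * poch (- INR k) n /
           (poch 1 n * poch (1 + a - b) n * poch (1 + a + INR k) n)).

Lemma poch_neg k : poch (- INR k) (S k) = 0.
Proof. simpl; ring. Qed.

(** The terms of orders k+1 and k agree at n = 0. At n+1 their difference is a multiple of the term
    n for a+2, b+1, because (n-k)(2+a+k+n) + (k+1)(1+a+k) = (n+1)(a+1+n). *)
Lemma wp_rec (W : C -> nat -> C) k a b :
  (forall n, W a (S n) = W (a + 2) n) ->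
  ~ nonpos_int (1 + a) -> ~ nonpos_int (1 + a - b) ->
  csum (wp_term W (S k) a b) (S (S k)) =
  csum (wp_term W k a b) (S k) -
  a * (a + 1) * b / ((1 + a - b) * (1 + a + INR k) * (2 + a + INR k)) *
  csum (wp_term W k (a + 2) (b + 1)) (S k).
Proof.
  intros HW Ha Hb; pose proof nonpos_1 as H1.
  (* Since (-k)_(k+1) = 0, the shorter sum can be lengthened by one term. *)
  replace (csum (wp_term W k a b) (S k)) with (csum (wp_term W k a b) (S (S k))).
  2:{ change (csum (wp_term W k a b) (S (S k))) with
        (csum (wp_term W k a b) (S k) + wp_term W k a b (S k)).
      unfold wp_term at 2; rewrite poch_neg; unfold Cdiv; ring. }
  rewrite (csum_Sl (wp_term W (S k) a b)), (csum_Sl (wp_term W k a b)).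
  rewrite <- csum_scal.
  set (f := fun i : nat => _ * _).
  replace (wp_term W k a b 0) with (wp_term W (S k) a b 0) by reflexivity.
  transitivity (wp_term W (S k) a b 0 +
    csum (fun i => wp_term W k a b (S i) + (-1) * f i) (S k)).
  2:{ rewrite csum_plus, csum_scal; ring. }
  f_equal; apply csum_ext; intros n _; unfold f, wp_term; rewrite HW.
  assert (K1 : 1 + a + INR k <> 0) by now apply nonpos_shift_neq0.
  assert (K2 : 2 + a + INR k <> 0).
  { replace (2 + a + INR k) with (1 + a + INR (S k)) by (rewrite INR_S; ring).
    now apply nonpos_shift_neq0. }
  assert (K3 : 2 + a + INR k + INR n <> 0).
  { replace (2 + a + INR k + INR n) with (1 + a + INR (S k + n))
      by (rewrite plus_INR, RtoC_plus, INR_S; ring).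
    now apply nonpos_shift_neq0. }
  assert (K4 : ~ nonpos_int (3 + a + INR k)).
  { replace (3 + a + INR k) with (1 + a + INR (S (S k)))
      by (rewrite !INR_S; ring).
    now apply nonpos_shift. }
  assert (K5 : ~ nonpos_int (2 + a - b)).
  { replace (2 + a - b) with (1 + a - b + INR 1) by (simpl INR; ring).
    now apply nonpos_shift. }
  assert (E1 : poch (2 + a + INR k) n =
    (2 + a + INR k) * poch (3 + a + INR k) n / (2 + a + INR k + INR n)).
  { replace (3 + a + INR k) with (2 + a + INR k + 1) by ring.
    rewrite <- poch_Sl; simpl; field; auto. }
  rewrite (poch_Sl (1 + a + INR k)), (poch_Sl (1 + a - b)), (poch_Sl b),
    (poch_Sl a), (poch_Sl (- INR (S k))), (poch_Sl (1 + a + INR (S k))).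
  simpl (poch (- INR k) (S n)); simpl (poch 1 (S n)).
  assert (E2 : poch (a + 1) n * (a + 1 + INR n) = (a + 1) * poch (a + 2) n).
  { replace (a + 2) with (a + 1 + 1) by ring. now rewrite <- poch_Sl. }
  rewrite !INR_S.
  replace (1 + a + INR k + 1) with (2 + a + INR k) by ring.
  replace (1 + a - b + 1) with (2 + a - b) by ring.
  replace (1 + (a + 2) - (b + 1)) with (2 + a - b) by ring.
  replace (1 + (a + 2) + INR k) with (3 + a + INR k) by ring.
  replace (1 + a + (INR k + 1) + 1) with (3 + a + INR k) by ring.
  replace (1 + a + (INR k + 1)) with (2 + a + INR k) by ring.
  replace (- (INR k + 1) + 1) with (- INR k) by ring.
  rewrite E1.
  assert (P1 := poch_neq0 _ n H1). assert (P2 := poch_neq0 _ n K4).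
  assert (P3 := poch_neq0 _ n K5). assert (P4 := nonpos_shift_neq0 1 n H1).
  assert (P5 := nonpos_neq0 _ Hb).
  (* The link between (a+1)_n and (a+2)_n is invisible to [field]; both sides are brought to a shape
     in which [E2] supplies it. *)
  transitivity (W (a + 2) n * a * b * poch (b + 1) n * poch (- INR k) n /
    (poch 1 n * (1 + INR n) * (1 + a - b) * poch (2 + a - b) n
      * (2 + a + INR k) * poch (3 + a + INR k) n) *
     (poch (a + 1) n * (- (INR k + 1)))); [field; auto 10|].
  replace (a * (a + 1) * b) with (a * b * (a + 1)) by ring.
  transitivity (W (a + 2) n * a * b * poch (b + 1) n * poch (- INR k) n /
    (poch 1 n * (1 + INR n) * (1 + a - b) * poch (2 + a - b) n
      * (2 + a + INR k) * poch (3 + a + INR k) n * (1 + a + INR k)) *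
     (poch (a + 1) n * (- INR k + INR n) * (2 + a + INR k + INR n)
      - ((a + 1) * poch (a + 2) n) * (1 + INR n))).
  2: field; auto 10.
  rewrite <- E2; field; auto 10.
Qed.


Lemma Csub_eq_0 (u v : C) : u - v = 0 -> u = v.
Proof. intros H; transitivity (u - v + v); [ring|rewrite H; ring]. Qed.

(** For W = 1, x = 1+a/2 this is Dixon's sum of a terminating 3F2; for W = a+2n, x = 1/2+a/2 it is
    the very-well-poised 4F3 sum. Induction on k moves to a+2, b+1, which leaves x - b unchanged,
    and the last hypothesis on [W] and [x] is what the induction step reduces to. *)
Lemma wp_sum (W : C -> nat -> C) (x : C -> C) k :
  (forall a n, W a (S n) = W (a + 2) n) ->
  (forall a, x (a + 2) = x a + 1) ->
  (forall a, W a O * (1 + a - x a) * (2 + a) = a * W (a + 2) O * x a) ->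
  forall a b, ~ nonpos_int (1 + a) -> ~ nonpos_int (1 + a - b) ->
  ~ nonpos_int (x a) ->
  csum (wp_term W k a b) (S k) =
  W a O * (poch (1 + a) k * poch (x a - b) k /
           (poch (x a) k * poch (1 + a - b) k)).
Proof.
  intros HW Hx HWx; induction k as [|k IH]; intros a b Ha Hb Hxa.
  { simpl; unfold wp_term; simpl; field. }
  assert (K5 : ~ nonpos_int (2 + a - b)).
  { replace (2 + a - b) with (1 + a - b + INR 1) by (simpl INR; ring).
    now apply nonpos_shift. }
  assert (K6 : ~ nonpos_int (x a + 1)) by (apply (nonpos_shift _ 1); easy).
  assert (K7 : ~ nonpos_int (2 + a)).
  { replace (2 + a) with (1 + a + INR 1) by (simpl INR; ring).
    now apply nonpos_shift. }
  rewrite wp_rec; auto.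
  rewrite IH by easy. rewrite IH; clear IH; cycle 1.
  { replace (1 + (a + 2)) with (1 + a + INR 2) by (simpl INR; rewrite RtoC_plus; ring).
    now apply nonpos_shift. }
  { now replace (1 + (a + 2) - (b + 1)) with (2 + a - b) by ring. }
  { now rewrite Hx. }
  rewrite Hx.
  replace (1 + (a + 2) - (b + 1)) with (1 + a - b + 1) by ring.
  replace (1 + (a + 2)) with (1 + a + 1 + 1) by ring.
  replace (x a + 1 - (b + 1)) with (x a - b) by ring.
  assert (Q1 := nonpos_neq0 _ Ha). assert (Q2 := nonpos_neq0 _ Hb).
  assert (Q3 := nonpos_neq0 _ Hxa). assert (Q4 := nonpos_neq0 _ K7).
  assert (Q5 := nonpos_shift_neq0 _ k Ha).
  assert (Q6 := nonpos_shift_neq0 _ k Hb).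
  assert (Q7 := nonpos_shift_neq0 _ k Hxa).
  assert (Q8 := nonpos_shift_neq0 _ k K7).
  assert (P1 := poch_neq0 _ k Ha). assert (P2 := poch_neq0 _ k Hb).
  assert (P3 := poch_neq0 _ k Hxa).
  assert (E1 : poch (1 + a - b + 1) k =
     poch (1 + a - b) k * (1 + a - b + INR k) / (1 + a - b)).
  { change (poch (1 + a - b) k * (1 + a - b + INR k)) with
      (poch (1 + a - b) (S k)). rewrite poch_Sl. now field. }
  assert (E2 : poch (x a + 1) k = poch (x a) k * (x a + INR k) / x a).
  { change (poch (x a) k * (x a + INR k)) with (poch (x a) (S k)).
    rewrite poch_Sl. now field. }
  assert (E3 : poch (1 + a + 1 + 1) k =
     poch (1 + a) k * (1 + a + INR k) * (2 + a + INR k) / ((1 + a) * (2 + a))).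
  { replace (2 + a + INR k) with (1 + a + INR (S k)) by (rewrite INR_S; ring).
    change (poch (1 + a) k * (1 + a + INR k) * (1 + a + INR (S k))) with
      (poch (1 + a) (S (S k))). rewrite !poch_Sl. field; auto. }
  rewrite E1, E2, E3; simpl poch.
  apply Csub_eq_0.
  set (X := x a) in *.
  (* The difference of the two sides is a common factor times the difference of the two sides of
     [HWx]. *)
  transitivity (poch (1 + a) k * poch (X - b) k * b
     / (poch X k * poch (1 + a - b) k * (X + INR k) * (1 + a - b + INR k) * (2 + a))
     * (W a O * (1 + a - X) * (2 + a) - a * W (a + 2) O * X)).
  { field; auto 15. }
  unfold X; rewrite <- HWx; ring.
Qed.

Lemma poch_neg_fact n j :
  poch (- INR (n + j)) n * poch 1 j = (-1) ^ n * poch 1 (n + j).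
Proof.
  induction n as [|n IH]; [unfold Cpow; simpl; ring|].
  rewrite poch_Sl; change (S n + j)%nat with (S (n + j)); rewrite INR_S.
  change (poch 1 (S (n + j))) with (poch 1 (n + j) * (1 + INR (n + j))).
  replace (- (INR (n + j) + 1) + 1) with (- INR (n + j)) by ring.
  rewrite Cpow_S.
  transitivity (- (INR (n + j) + 1) * (poch (- INR (n + j)) n * poch 1 j));
    [ring|rewrite IH; ring].
Qed.

(* Bailey's transform: [wp_sum] gives the inner sum over n, [Pfaff_Saalschutz]
   the inner sum over k after the order of summation is exchanged. *)
Lemma well_poised_terminating (W : C -> nat -> C) (x : C -> C) a b c d m :
  (forall a n, W a (S n) = W (a + 2) n) ->
  (forall a, x (a + 2) = x a + 1) ->
  (forall a, W a O * (1 + a - x a) * (2 + a) = a * W (a + 2) O * x a) ->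
  ~ nonpos_int (1 + a) -> ~ nonpos_int (1 + a - b) ->
  ~ nonpos_int (1 + a - c) -> ~ nonpos_int (1 + a - d) ->
  ~ nonpos_int (1 + a - c - d) -> ~ nonpos_int (x a) ->
  csum (fun n => W a n * (poch a n * poch b n * poch c n * poch d n /
       (poch 1 n * poch (1 + a - b) n * poch (1 + a - c) n *
        poch (1 + a - d) n)) *
       (poch (- INR m) n / poch (1 + a + INR m) n)) (S m) =
  W a O * (poch (1 + a) m * poch (1 + a - c - d) m /
           (poch (1 + a - c) m * poch (1 + a - d) m)) *
  csum (fun k => poch c k * poch d k * poch (x a - b) k /
       (poch 1 k * poch (x a) k * poch (1 + a - b) k) *
       (poch (1 + a - c - d) (m - k) / poch 1 (m - k) *
        (poch 1 m / poch (1 + a - c - d) m))) (S m).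
Proof.
  intros HW Hx HWx Ha Hb Hc Hd Hs Hxa; pose proof nonpos_1 as H1.
  assert (Pm1 := poch_neq0 _ m H1). assert (Pma := poch_neq0 _ m Ha).
  assert (Pmc := poch_neq0 _ m Hc). assert (Pmd := poch_neq0 _ m Hd).
  assert (Pms := poch_neq0 _ m Hs).
  set (s := 1 + a - c - d) in *.
  (* Over 0 <= n <= k <= m, summing [f] first over n leads to the right-hand side, summing first
     over k to the left-hand side. *)
  set (f := fun k n => poch c k * poch d k / (poch 1 k * poch (1 + a) k) *
     (poch s (m - k) / poch 1 (m - k)) * wp_term W k a b n).
  transitivity (poch (1 + a) m * poch 1 m /
     (poch (1 + a - c) m * poch (1 + a - d) m) *
     csum (fun k => csum (fun n => f k n) (S k)) (S m)).
  2:{ transitivity (poch (1 + a) m * poch 1 m /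
       (poch (1 + a - c) m * poch (1 + a - d) m) *
       csum (fun k => W a O * (poch c k * poch d k * poch (x a - b) k /
       (poch 1 k * poch (x a) k * poch (1 + a - b) k) *
       (poch s (m - k) / poch 1 (m - k) *
        (poch 1 m / poch s m))) * (poch s m / poch 1 m)) (S m)).
      - f_equal. apply csum_ext; intros k Hk. unfold f. rewrite csum_scal.
        rewrite (wp_sum W x) by easy.
        assert (P1 := poch_neq0 _ k H1). assert (P2 := poch_neq0 _ (m - k) H1).
        assert (P3 := poch_neq0 _ k Ha). assert (P4 := poch_neq0 _ k Hxa).
        assert (P5 := poch_neq0 _ k Hb). field; auto 10.
      - rewrite (csum_ext _ (fun k => (W a O * (poch s m / poch 1 m)) *
          (poch c k * poch d k * poch (x a - b) k /
           (poch 1 k * poch (x a) k * poch (1 + a - b) k) *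
           (poch s (m - k) / poch 1 (m - k) * (poch 1 m / poch s m))))).
        2:{ intros; ring. }
        rewrite csum_scal. field; auto. }
  rewrite csum_triangle, <- csum_scal.
  apply csum_ext; intros n Hn.
  destruct (Nat.le_exists_sub n m) as [M [EM _]]; [lia|].
  replace (S m - n)%nat with (S M) by lia.
  assert (Ha2 : ~ nonpos_int (1 + a + INR (n + n))) by now apply nonpos_shift.
  assert (P1 := poch_neq0 _ n H1). assert (P2 := poch_neq0 _ n Hb).
  assert (P3 := poch_neq0 _ (n + n) Ha). assert (P4 := poch_neq0 _ n Hc).
  assert (P5 := poch_neq0 _ n Hd).
  assert (P6 := poch_neq0 _ M H1). assert (P7 := poch_neq0 _ M Ha2).
  assert (P8 := poch_neq0 _ n (nonpos_shift _ m Ha)).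
  rewrite (csum_ext _ (fun j => ((-1) ^ n * (W a n * (poch a n * poch b n) /
     (poch 1 n * poch (1 + a - b) n)) *
     (poch c n * poch d n / poch (1 + a) (n + n))) *
     (poch (c + INR n) j * poch (d + INR n) j * poch s (M - j) /
        (poch 1 j * poch 1 (M - j) * poch (1 + a + INR (n + n)) j)))).
  2:{ intros j Hj. unfold f, wp_term.
      replace (m - (n + j))%nat with (M - j)%nat by lia.
      assert (E : poch (- INR (n + j)) n = (-1) ^ n * poch 1 (n + j) / poch 1 j).
      { rewrite <- poch_neg_fact. field. now apply poch_neq0. }
      rewrite E.
      (* Both products are (1+a)_(2n+j). *)
      assert (E2 : poch (1 + a) (n + j) * poch (1 + a + INR (n + j)) n =
        poch (1 + a) (n + n) * poch (1 + a + INR (n + n)) j).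
      { rewrite <- !poch_add. f_equal; lia. }
      assert (R1 := poch_neq0 _ j H1). assert (R2 := poch_neq0 _ (M - j) H1).
      assert (R3 := poch_neq0 _ (n + j) Ha). assert (R4 := poch_neq0 _ j Ha2).
      assert (R5 := poch_neq0 _ (n + j) H1).
      assert (R6 := poch_neq0 _ n (nonpos_shift _ (n + j) Ha)).
      rewrite (poch_add c), (poch_add d).
      set (Y := poch (1 + a) (n + n) * poch (1 + a + INR (n + n)) j) in *.
      transitivity (poch c n * poch (c + INR n) j * (poch d n * poch (d + INR n) j) *
        poch s (M - j) * W a n * poch a n * poch b n * (-1) ^ n /
        (poch 1 j * poch 1 (M - j) * poch 1 n * poch (1 + a - b) n * 
         (poch (1 + a) (n + j) * poch (1 + a + INR (n + j)) n))).
      { field; auto 10. }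
      rewrite E2; unfold Y; field; auto 10. }
  (* The inner sum is balanced for every n with the same s, as (1+a+2n) - (c+n) - (d+n) =
     1+a-c-d. *)
  rewrite csum_scal, Pfaff_Saalschutz.
  2:{ rewrite plus_INR, RtoC_plus; unfold s; ring. }
  2: easy.
  replace (1 + a + INR (n + n) - (c + INR n)) with (1 + a - c + INR n)
    by (rewrite plus_INR, RtoC_plus; ring).
  replace (1 + a + INR (n + n) - (d + INR n)) with (1 + a - d + INR n)
    by (rewrite plus_INR, RtoC_plus; ring).
  assert (E : poch (- INR m) n = (-1) ^ n * poch 1 m / poch 1 M).
  { replace m with (n + M)%nat by lia. rewrite <- poch_neg_fact. now field. }
  assert (E2 : poch (1 + a) m * poch (1 + a + INR m) n =
    poch (1 + a) (n + n) * poch (1 + a + INR (n + n)) M).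
  { rewrite <- !poch_add. f_equal; lia. }
  assert (E3 : poch (1 + a - c) m = poch (1 + a - c) n * poch (1 + a - c + INR n) M).
  { rewrite <- !poch_add. f_equal; lia. }
  assert (E4 : poch (1 + a - d) m = poch (1 + a - d) n * poch (1 + a - d + INR n) M).
  { rewrite <- !poch_add. f_equal; lia. }
  assert (P9 : poch (1 + a - c + INR n) M <> 0)
    by now apply poch_neq0, nonpos_shift.
  assert (P10 : poch (1 + a - d + INR n) M <> 0)
    by now apply poch_neq0, nonpos_shift.
  rewrite E.
  replace (poch (1 + a + INR m) n) with
    (poch (1 + a) (n + n) * poch (1 + a + INR (n + n)) M / poch (1 + a) m)
    by (rewrite <- E2; field; auto).
  rewrite E3, E4. field; auto 15.
Qed.

(** * Complex limits *)


(** Componentwise, to match [CLim_seq] and [CSeries]; [Ccv_Cmod] gives the passage to moduli for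
    estimates. *)
Definition Ccv (u : nat -> C) (l : C) : Prop :=
  is_lim_seq (fun n => Re (u n)) (Re l) /\ is_lim_seq (fun n => Im (u n)) (Im l).

Lemma Ccv_const l : Ccv (fun _ => l) l.
Proof. split; apply is_lim_seq_const. Qed.

Lemma Ccv_ext_loc u v l N :
  (forall n, (N <= n)%nat -> u n = v n) -> Ccv u l -> Ccv v l.
Proof.
  intros H [H1 H2]; split; eapply is_lim_seq_ext_loc; try eassumption;
    exists N; intros n Hn; now rewrite H.
Qed.

Lemma Ccv_plus u v l k : Ccv u l -> Ccv v k -> Ccv (fun n => u n + v n) (l + k).
Proof.
  intros [H1 H2] [H3 H4]; split; simpl; now apply is_lim_seq_plus'.
Qed.

Lemma Ccv_mult u v l k : Ccv u l -> Ccv v k -> Ccv (fun n => u n * v n) (l * k).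
Proof.
  intros [H1 H2] [H3 H4]; split; simpl.
  - apply is_lim_seq_minus'; now apply is_lim_seq_mult'.
  - apply is_lim_seq_plus'; now apply is_lim_seq_mult'.
Qed.

Lemma Ccv_scal c u l : Ccv u l -> Ccv (fun n => c * u n) (c * l).
Proof. apply Ccv_mult, Ccv_const. Qed.

Lemma Ccv_unique u l k : Ccv u l -> Ccv u k -> l = k.
Proof.
  intros [H1 H2] [H3 H4].
  apply is_lim_seq_unique in H1, H2, H3, H4.
  apply injective_projections.
  - change (Re l = Re k); rewrite H1 in H3; now inversion H3.
  - change (Im l = Im k); rewrite H2 in H4; now inversion H4.
Qed.

Lemma Ccv_subseq u l k : Ccv u l -> Ccv (fun n => u (n + k)%nat) l.
Proof.
  intros [H1 H2]; split.
  - now apply (is_lim_seq_incr_n (fun n => Re (u n))).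
  - now apply (is_lim_seq_incr_n (fun n => Im (u n))).
Qed.

Lemma Ccv_subseq_inv u l k : Ccv (fun n => u (n + k)%nat) l -> Ccv u l.
Proof.
  intros [H1 H2]; split.
  - now apply (is_lim_seq_incr_n (fun n => Re (u n))) in H1.
  - now apply (is_lim_seq_incr_n (fun n => Im (u n))) in H2.
Qed.

Lemma re_le_Cmod z : (Rabs (Re z) <= Cmod z)%R.
Proof. eapply Rle_trans; [apply Rmax_l|apply Rmax_Cmod]. Qed.

Lemma im_le_Cmod z : (Rabs (Im z) <= Cmod z)%R.
Proof. eapply Rle_trans; [apply Rmax_r|apply Rmax_Cmod]. Qed.

Lemma Cmod_le_re_im z : (Cmod z <= Rabs (Re z) + Rabs (Im z))%R.
Proof.
  replace z with (RtoC (Re z) + Ci * RtoC (Im z)) at 1.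
  2:{ destruct z as [x y]; unfold Ci; apply injective_projections; simpl; ring. }
  eapply Rle_trans; [apply Cmod_triangle|].
  rewrite Cmod_mult, !Cmod_R, Cmod_Ci. lra.
Qed.

Lemma lim0_squeeze u v : (forall n, (0 <= u n <= v n)%R) ->
  is_lim_seq v 0 -> is_lim_seq u 0.
Proof.
  intros H Hv. apply (is_lim_seq_le_le (fun _ => 0%R) u v); auto.
  apply is_lim_seq_const.
Qed.

Lemma Ccv_Cmod u l : Ccv u l <-> is_lim_seq (fun n => Cmod (u n - l)) 0.
Proof.
  split.
  - intros [H1 H2].
    apply lim0_squeeze with
      (fun n => (Rabs (Re (u n) - Re l) + Rabs (Im (u n) - Im l))%R).
    { intros n; split; [apply Cmod_ge_0|].
      apply (Cmod_le_re_im (u n - l)). }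
    replace 0%R with (0 + 0)%R by ring.
    apply is_lim_seq_plus';
      apply (proj1 (is_lim_seq_abs_0 _));
      [replace 0%R with (Re l - Re l)%R by ring
      |replace 0%R with (Im l - Im l)%R by ring];
      apply is_lim_seq_minus'; auto; apply is_lim_seq_const.
  - intros H; split.
    + replace (Re l) with (0 + Re l)%R by ring.
      apply is_lim_seq_ext with (fun n => (Re (u n - l) + Re l)%R).
      { intros; unfold Re, Im; simpl; ring. }
      apply is_lim_seq_plus'; [|apply is_lim_seq_const].
      apply (proj2 (is_lim_seq_abs_0 _)).
      apply lim0_squeeze with (2 := H).
      intros n; split; [apply Rabs_pos|apply re_le_Cmod].
    + replace (Im l) with (0 + Im l)%R by ring.
      apply is_lim_seq_ext with (fun n => (Im (u n - l) + Im l)%R).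
      { intros; unfold Re, Im; simpl; ring. }
      apply is_lim_seq_plus'; [|apply is_lim_seq_const].
      apply (proj2 (is_lim_seq_abs_0 _)).
      apply lim0_squeeze with (2 := H).
      intros n; split; [apply Rabs_pos|apply im_le_Cmod].
Qed.

Lemma Ccv_Cmod_lim u l : Ccv u l -> is_lim_seq (fun n => Cmod (u n)) (Cmod l).
Proof.
  intros H; apply Ccv_Cmod in H.
  replace (Cmod l) with (0 + Cmod l)%R by ring.
  apply is_lim_seq_ext with (fun n => (Cmod (u n) - Cmod l + Cmod l)%R).
  { intros; ring. }
  apply is_lim_seq_plus'; [|apply is_lim_seq_const].
  apply (proj2 (is_lim_seq_abs_0 _)).
  apply lim0_squeeze with (2 := H).
  intros n; split; [apply Rabs_pos|].
  apply Rabs_le; split.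
  - generalize (Cmod_triangle (u n) (l - u n)).
    replace (u n + (l - u n)) with l by ring.
    replace (l - u n) with (- (u n - l)) by ring. rewrite Cmod_opp. lra.
  - generalize (Cmod_triangle l (u n - l)).
    replace (l + (u n - l)) with (u n) by ring. lra.
Qed.

Lemma lim_bounded u l : is_lim_seq u (Finite l) ->
  exists M, forall n, (u n <= M)%R.
Proof.
  intros H. destruct (filterlim_bounded u) as [M HM].
  - now exists l.
  - exists M; intros n. eapply Rle_trans; [apply Rle_abs|apply HM].
Qed.

Lemma lim0_spec u : is_lim_seq u 0 -> forall eps, (0 < eps)%R ->
  exists N, forall n, (N <= n)%nat -> (u n < eps)%R.
Proof.
  intros H eps He. apply is_lim_seq_spec in H.
  destruct (H (mkposreal eps He)) as [N HN]; exists N; intros n Hn.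
  specialize (HN n Hn); simpl in HN. rewrite Rminus_0_r in HN.
  now apply Rle_lt_trans with (2 := HN), Rle_abs.
Qed.

Lemma lim0_intro u : (forall n, (0 <= u n)%R) ->
  (forall eps, (0 < eps)%R -> exists N, forall n, (N <= n)%nat -> (u n <= eps)%R) ->
  is_lim_seq u 0.
Proof.
  intros Hp H. apply is_lim_seq_spec; intros [eps He].
  destruct (H (eps / 2)%R) as [N HN]; [lra|].
  exists N; intros n Hn; simpl. rewrite Rminus_0_r, Rabs_pos_eq by easy.
  specialize (HN n Hn); lra.
Qed.

(** * Real sums, absolute convergence and infinite products *)

Fixpoint rsum (f : nat -> R) (n : nat) : R :=
  match n with
  | O => 0
  | S m => rsum f m + f m
  end%R.

Lemma rsum_le f g n :
  (forall i, (i < n)%nat -> (f i <= g i)%R) -> (rsum f n <= rsum g n)%R.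
Proof.
  induction n as [|n IH]; intros H; simpl; [lra|].
  apply Rplus_le_compat; [apply IH; intros|]; apply H; lia.
Qed.

Lemma rsum_plus f g n : rsum (fun i => f i + g i)%R n = (rsum f n + rsum g n)%R.
Proof. induction n as [|n IH]; simpl; [ring|rewrite IH; ring]. Qed.

Lemma rsum_scal c f n : rsum (fun i => c * f i)%R n = (c * rsum f n)%R.
Proof. induction n as [|n IH]; simpl; [ring|rewrite IH; ring]. Qed.

Lemma rsum_add f N k : rsum f (N + k) = (rsum f N + rsum (fun i => f (N + i)%nat) k)%R.
Proof.
  induction k as [|k IH]; [rewrite Nat.add_0_r; simpl; ring|].
  rewrite Nat.add_succ_r; simpl; rewrite IH; ring.
Qed.

Lemma rsum_ge0 f n : (forall i, (0 <= f i)%R) -> (0 <= rsum f n)%R.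
Proof.
  intros H; induction n as [|n IH]; simpl; [lra|]. specialize (H n); lra.
Qed.

Lemma rsum_incr f n m : (forall i, (0 <= f i)%R) -> (n <= m)%nat ->
  (rsum f n <= rsum f m)%R.
Proof.
  intros H Hn. replace m with (n + (m - n))%nat by lia. rewrite rsum_add.
  generalize (rsum_ge0 (fun i => f (n + i)%nat) (m - n) (fun i => H _)); lra.
Qed.

Lemma rsum_telescope g n : rsum (fun i => g (S i) - g i)%R n = (g n - g O)%R.
Proof. induction n as [|n IH]; simpl; [ring|rewrite IH; ring]. Qed.

Lemma Cmod_csum f n : (Cmod (csum f n) <= rsum (fun i => Cmod (f i)) n)%R.
Proof.
  induction n as [|n IH]; simpl; [rewrite Cmod_0; lra|].
  eapply Rle_trans; [apply Cmod_triangle|lra].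
Qed.

Lemma csum_add f N k : csum f (N + k) = csum f N + csum (fun i => f (N + i)%nat) k.
Proof.
  induction k as [|k IH]; [rewrite Nat.add_0_r; simpl; ring|].
  rewrite Nat.add_succ_r; simpl; rewrite IH; ring.
Qed.

(** For nonnegative [f] this is summability, in a form that allows comparison without naming a
    sum. *)
Definition bsum (f : nat -> R) : Prop := exists M, forall n, (rsum f n <= M)%R.

Lemma bsum_le f g N :
  (forall n, (N <= n)%nat -> (f n <= g n)%R) -> (forall n, (0 <= g n)%R) ->
  (forall n, (0 <= f n)%R) -> bsum g -> bsum f.
Proof.
  intros H Hg Hf [M HM]. exists (rsum f N + M)%R; intros n.
  apply Rle_trans with (rsum f (N + n)); [apply rsum_incr; auto; lia|].
  rewrite rsum_add. apply Rplus_le_compat_l.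
  apply Rle_trans with (rsum (fun i => g (N + i)%nat) n).
  - apply rsum_le; intros; apply H; lia.
  - specialize (HM (N + n)%nat). rewrite rsum_add in HM.
    generalize (rsum_ge0 g N Hg); lra.
Qed.

Lemma bsum_scal c f : (0 <= c)%R -> bsum f -> bsum (fun n => c * f n)%R.
Proof.
  intros Hc [M HM]; exists (c * M)%R; intros n; rewrite rsum_scal.
  now apply Rmult_le_compat_l.
Qed.

Lemma bsum_tail f : (forall i, (0 <= f i)%R) -> bsum f ->
  forall eps, (0 < eps)%R -> exists N, forall n, (N <= n)%nat ->
    (rsum f n - rsum f N <= eps)%R.
Proof.
  intros Hf [M HM] eps He.
  assert (H : ex_finite_lim_seq (rsum f)).
  { apply ex_finite_lim_seq_incr with M; auto.
    intros n; simpl; specialize (Hf n); lra. }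
  destruct H as [l Hl]. assert (Hl' := Hl). apply is_lim_seq_spec in Hl.
  destruct (Hl (mkposreal eps He)) as [N HN]; exists N; intros n Hn.
  specialize (HN N (le_n _)); simpl in HN; apply Rabs_def2 in HN.
  assert (rsum f n <= l)%R; [|lra].
  apply (is_lim_seq_incr_compare (rsum f)); auto.
  intros k; simpl; specialize (Hf k); lra.
Qed.

Lemma abs_cv t : bsum (fun n => Cmod (t n)) -> exists l, Ccv (csum t) l.
Proof.
  intros H.
  (* [p] stands for [Re] and for [Im], so that the Cauchy argument is made once. *)
  assert (K : forall p : C -> R, (forall z, (Rabs (p z) <= Cmod z)%R) ->
     (forall x y, p (x - y) = (p x - p y)%R) ->
     ex_finite_lim_seq (fun n => p (csum t n))).
  { intros p Hp Hm. apply ex_lim_seq_cauchy_corr. intros [eps He].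
    destruct (bsum_tail _ (fun i => Cmod_ge_0 (t i)) H (eps / 3)%R) as [N HN]; [lra|].
    assert (HN' : forall n, (N <= n)%nat -> (Cmod (csum t n - csum t N) <= eps / 3)%R).
    { intros n Hn. replace n with (N + (n - N))%nat in * by lia.
      set (k := (n - N)%nat) in *. rewrite csum_add.
      replace (csum t N + csum (fun i => t (N + i)%nat) k - csum t N)
        with (csum (fun i => t (N + i)%nat) k) by ring.
      eapply Rle_trans; [apply Cmod_csum|].
      specialize (HN (N + k)%nat ltac:(lia)). rewrite rsum_add in HN. lra. }
    exists N; intros n m Hn Hm'; simpl. rewrite <- Hm.
    eapply Rle_lt_trans; [apply Hp|].
    replace (csum t n - csum t m) with
      ((csum t n - csum t N) + - (csum t m - csum t N)) by ring.
    eapply Rle_lt_trans; [apply Cmod_triangle|]. rewrite Cmod_opp.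
    assert (A := HN' n Hn). assert (B := HN' m Hm'). lra. }
  destruct (K Re re_le_Cmod) as [x Hx]; [intros; unfold Re, Im; simpl; ring|].
  destruct (K Im im_le_Cmod) as [y Hy]; [intros; unfold Re, Im; simpl; ring|].
  exists (x, y); now split.
Qed.

Lemma rsum_lim0 (f : nat -> nat -> R) N :
  (forall n, is_lim_seq (fun m => f m n) 0) ->
  is_lim_seq (fun m => rsum (f m) N) 0.
Proof.
  intros H; induction N as [|N IH]; simpl; [apply is_lim_seq_const|].
  replace 0%R with (0 + 0)%R by ring. now apply is_lim_seq_plus'.
Qed.

(** The common core of [regular_summation] and [Tannery]: terms that vanish individually, and tails
    that are small uniformly in m, although the number of terms grows with m. *)
Lemma rsum_null (f : nat -> nat -> R) :
  (forall m n, (0 <= f m n)%R) ->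
  (forall n, is_lim_seq (fun m => f m n) 0) ->
  (forall eps, (0 < eps)%R -> exists N M, forall m, (M <= m)%nat ->
      (rsum (f m) (S m) <= rsum (f m) N + eps)%R) ->
  is_lim_seq (fun m => rsum (f m) (S m)) 0.
Proof.
  intros Hp Hl H. apply lim0_intro; [intros; now apply rsum_ge0|].
  intros eps He. destruct (H (eps / 2)%R) as [N [M HM]]; [lra|].
  destruct (lim0_spec _ (rsum_lim0 f N Hl) (eps / 2)%R) as [K HK]; [lra|].
  exists (max M K); intros m Hm.
  specialize (HM m ltac:(lia)). specialize (HK m ltac:(lia)). lra.
Qed.

(** The bound |x n| <= |x 0| exp (e 0 + ... + e (n-1)) makes the increments x n (r n - 1) absolutely
    summable. *)
Lemma Ccv_prod_bounded (x r : nat -> C) (e : nat -> R) :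
  (forall n, x (S n) = x n * r n) -> (forall n, (Cmod (r n - 1) <= e n)%R) ->
  bsum e -> exists l, Ccv x l.
Proof.
  intros Hx Hr He.
  assert (He0 : forall n, (0 <= e n)%R).
  { intros n; eapply Rle_trans; [apply Cmod_ge_0|apply Hr]. }
  assert (B : exists M, forall n, (Cmod (x n) <= M)%R).
  { destruct He as [M HM]. exists (Cmod (x O) * exp M)%R; intros n.
    apply Rle_trans with (Cmod (x O) * exp (rsum e n))%R.
    - induction n as [|n IH]; simpl; [rewrite exp_0; lra|].
      rewrite Hx, Cmod_mult, exp_plus, <- Rmult_assoc.
      apply Rmult_le_compat; auto using Cmod_ge_0.
      replace (r n) with (1 + (r n - 1)) by ring.
      eapply Rle_trans; [apply Cmod_triangle|]. rewrite Cmod_1.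
      specialize (Hr n). generalize (exp_ineq1_le (e n)); lra.
    - apply Rmult_le_compat_l; [apply Cmod_ge_0|].
      destruct (HM n) as [H|H]; [left; now apply exp_increasing|right; now rewrite H]. }
  destruct B as [M HM].
  destruct (abs_cv (fun n => x (S n) - x n)) as [l Hl].
  { apply bsum_le with (fun n => M * e n)%R O; auto using Cmod_ge_0.
    - intros n _. rewrite Hx. replace (x n * r n - x n) with (x n * (r n - 1)) by ring.
      rewrite Cmod_mult. apply Rmult_le_compat; auto using Cmod_ge_0.
    - intros n. apply Rmult_le_pos; auto.
      eapply Rle_trans; [apply Cmod_ge_0|apply (HM O)].
    - apply bsum_scal; auto. eapply Rle_trans; [apply Cmod_ge_0|apply (HM O)]. }
  exists (l + x O). apply Ccv_ext_loc with (fun n => csum (fun n => x (S n) - x n) n + x O) O.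
  { intros n _. rewrite csum_telescope; ring. }
  apply Ccv_plus; auto using Ccv_const.
Qed.

(* The inverses [/ x n] converge as well, so the limit cannot vanish. *)
Lemma Ccv_prod_nonzero (x r : nat -> C) (e : nat -> R) :
  (forall n, x (S n) = x n * r n) -> (forall n, (Cmod (r n - 1) <= e n)%R) ->
  (forall n, (e n <= 1 / 2)%R) -> bsum e -> x O <> 0 ->
  exists l : C, l <> 0 /\ Ccv x l.
Proof.
  intros Hx Hr Hs He H0.
  assert (He0 : forall n, (0 <= e n)%R).
  { intros n; eapply Rle_trans; [apply Cmod_ge_0|apply Hr]. }
  assert (Hr2 : forall n, (1 / 2 <= Cmod (r n))%R).
  { intros n. generalize (Cmod_triangle (r n) (- (r n - 1))).
    replace (r n + - (r n - 1)) with (RtoC 1) by ring.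
    rewrite Cmod_1, Cmod_opp. specialize (Hr n); specialize (Hs n); lra. }
  assert (Hr0 : forall n, r n <> 0).
  { intros n E. specialize (Hr2 n). rewrite E, Cmod_0 in Hr2; lra. }
  assert (Hx0 : forall n, x n <> 0).
  { induction n as [|n IH]; [easy|rewrite Hx; now apply Cmult_neq_0]. }
  destruct (Ccv_prod_bounded x r e Hx Hr He) as [l Hl].
  (* The factor 2 comes from |r n| >= 1/2. *)
  destruct (Ccv_prod_bounded (fun n => / x n) (fun n => / r n) (fun n => 2 * e n)%R)
    as [k Hk].
  - intros n. rewrite Hx. field; auto.
  - intros n. replace (/ r n - 1) with (- (r n - 1) / r n) by (field; auto).
    rewrite Cmod_div, Cmod_opp by auto.
    apply Rle_div_l; [specialize (Hr2 n); lra|].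
    specialize (Hr n); specialize (Hr2 n); specialize (He0 n).
    nra.
  - apply bsum_scal; auto; lra.
  - exists l; split; auto. intros E.
    assert (F : Ccv (fun n => x n * / x n) (l * k)) by now apply Ccv_mult.
    assert (G : l * k = 1).
    { apply Ccv_unique with (1 := F).
      apply Ccv_ext_loc with (2 := Ccv_const 1) (N := O).
      intros; field; auto. }
    rewrite E, Cmult_0_l in G. apply RtoC_inj in G; lra.
Qed.

(** * Powers and the exponential *)


(** The base n+1 instead of n lets every growth estimate hold from n = 0 on. *)
Definition pw (n : nat) (p : R) : R := Rpower (INR n + 1) p.

Lemma pw_pos n p : (0 < pw n p)%R.
Proof. apply exp_pos. Qed.

Lemma pw_plus n p q : (pw n (p + q) = pw n p * pw n q)%R.
Proof. apply Rpower_plus. Qed.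

Lemma pw_0 n : pw n 0 = 1%R.
Proof. apply Rpower_O. generalize (pos_INR n); lra. Qed.

Lemma ln_le_sub1 y : (0 < y)%R -> (ln y <= y - 1)%R.
Proof.
  intros H. generalize (exp_ineq1_le (ln y)). rewrite exp_ln by easy; lra.
Qed.

Lemma ln_diff_lower x y : (0 < x)%R -> (0 < y)%R -> (1 - x / y <= ln y - ln x)%R.
Proof.
  intros Hx Hy. rewrite <- (Ropp_involutive (ln y - ln x)).
  replace (- (ln y - ln x))%R with (ln x - ln y)%R by ring.
  rewrite <- ln_div by easy.
  generalize (ln_le_sub1 (x / y) (Rdiv_lt_0_compat x y Hx Hy)); lra.
Qed.

Lemma one_minus_exp t u : (0 <= u <= t)%R -> (u / (1 + u) <= 1 - exp (- t))%R.
Proof.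
  intros [Hu Ht]. rewrite exp_Ropp.
  assert (H : (1 + u <= exp t)%R) by (generalize (exp_ineq1_le t); lra).
  assert (H2 : (/ exp t <= / (1 + u))%R) by (apply Rinv_le_contravar; lra).
  replace (u / (1 + u))%R with (1 - / (1 + u))%R by (field; lra). lra.
Qed.

(** A telescoping substitute for the integral test: it bounds the sum of (n+1)^p for p = -q-1 < -1.
    The counterpart [pw_diff_pos] bounds the growth of such sums for p = q-1 > -1. *)
Lemma pw_diff_neg q n : (0 < q)%R ->
  (q / (2 + q) * pw n (- q - 1) <= pw n (- q) - pw (S n) (- q))%R.
Proof.
  intros Hq. unfold pw. rewrite S_INR.
  set (Y := (INR n + 1)%R). assert (HY : (1 <= Y)%R) by (unfold Y; generalize (pos_INR n); lra).
  set (t := (q * (ln (Y + 1) - ln Y))%R).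
  assert (E : Rpower (Y + 1) (- q) = (Rpower Y (- q) * exp (- t))%R).
  { unfold Rpower. rewrite <- exp_plus. f_equal; unfold t; ring. }
  assert (E2 : Rpower Y (- q - 1) = (Rpower Y (- q) / Y)%R).
  { unfold Rminus; rewrite Rpower_plus, (Rpower_Ropp _ 1), Rpower_1 by lra. reflexivity. }
  rewrite E, E2.
  assert (L := ln_diff_lower Y (Y + 1) ltac:(lra) ltac:(lra)).
  (* The constant q/(2+q) arises from 1/(Y+1) >= 1/(2Y) and 2Y+q <= (2+q)Y, both valid as Y >= 1. *)
  assert (L2 : (/ (2 * Y) <= 1 - Y / (Y + 1))%R).
  { replace (1 - Y / (Y + 1))%R with (/ (Y + 1))%R by (field; lra).
    apply Rinv_le_contravar; lra. }
  assert (Hi : (0 < / (2 * Y))%R) by (apply Rinv_0_lt_compat; lra).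
  assert (T := one_minus_exp t (q * / (2 * Y)) ltac:(unfold t; nra)).
  assert (T2 : (q / (2 + q) / Y <= q * / (2 * Y) / (1 + q * / (2 * Y)))%R).
  { replace (q * / (2 * Y) / (1 + q * / (2 * Y)))%R with (q / (2 * Y + q))%R
      by (field; nra).
    replace (q / (2 + q) / Y)%R with (q / (Y * (2 + q)))%R by (field; lra).
    unfold Rdiv; apply Rmult_le_compat_l; [lra|]. apply Rinv_le_contravar; nra. }
  assert (P : (0 < Rpower Y (- q))%R) by apply exp_pos.
  replace (q / (2 + q) * (Rpower Y (- q) / Y))%R
    with (Rpower Y (- q) * (q / (2 + q) / Y))%R by (field; lra).
  nra.
Qed.

Lemma pw_diff_pos q n : (0 < q)%R ->
  (q / (1 + q) * pw (S n) (q - 1) <= pw (S n) q - pw n q)%R.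
Proof.
  intros Hq. unfold pw. rewrite S_INR.
  set (Y := (INR n + 1)%R). assert (HY : (1 <= Y)%R) by (unfold Y; generalize (pos_INR n); lra).
  set (t := (q * (ln (Y + 1) - ln Y))%R).
  assert (E : Rpower Y q = (Rpower (Y + 1) q * exp (- t))%R).
  { unfold Rpower. rewrite <- exp_plus. f_equal; unfold t; ring. }
  assert (E2 : Rpower (Y + 1) (q - 1) = (Rpower (Y + 1) q / (Y + 1))%R).
  { unfold Rminus; rewrite Rpower_plus, (Rpower_Ropp _ 1), Rpower_1 by lra. reflexivity. }
  rewrite E, E2.
  assert (L := ln_diff_lower Y (Y + 1) ltac:(lra) ltac:(lra)).
  replace (1 - Y / (Y + 1))%R with (/ (Y + 1))%R in L by (field; lra).
  assert (Hi : (0 < / (Y + 1))%R) by (apply Rinv_0_lt_compat; lra).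
  assert (T := one_minus_exp t (q * / (Y + 1)) ltac:(unfold t; nra)).
  assert (T2 : (q / (1 + q) / (Y + 1) <= q * / (Y + 1) / (1 + q * / (Y + 1)))%R).
  { replace (q * / (Y + 1) / (1 + q * / (Y + 1)))%R with (q / (Y + 1 + q))%R
      by (field; nra).
    replace (q / (1 + q) / (Y + 1))%R with (q / ((Y + 1) * (1 + q)))%R by (field; lra).
    unfold Rdiv; apply Rmult_le_compat_l; [lra|]. apply Rinv_le_contravar; nra. }
  assert (P : (0 < Rpower (Y + 1) q)%R) by apply exp_pos.
  replace (q / (1 + q) * (Rpower (Y + 1) q / (Y + 1)))%R
    with (Rpower (Y + 1) q * (q / (1 + q) / (Y + 1)))%R by (field; lra).
  nra.
Qed.

Lemma bsum_pw p : (p < -1)%R -> bsum (fun n => pw n p).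
Proof.
  intros Hp. set (q := (- p - 1)%R). assert (Hq : (0 < q)%R) by (unfold q; lra).
  exists ((2 + q) / q)%R; intros n.
  assert (H : (q / (2 + q) * rsum (fun n => pw n p) n <= 1)%R).
  { rewrite <- rsum_scal.
    apply Rle_trans with (rsum (fun i => - pw (S i) (- q) - - pw i (- q))%R n).
    - apply rsum_le; intros i _. generalize (pw_diff_neg q i Hq).
      replace (- q - 1)%R with p by (unfold q; ring). lra.
    - rewrite (rsum_telescope (fun i => - pw i (- q))%R).
      generalize (pw_pos n (- q)).
      replace (pw 0 (- q)) with 1%R; [lra|].
      unfold pw; simpl; rewrite Rplus_0_l. unfold Rpower; rewrite ln_1, Rmult_0_r, exp_0.
      reflexivity. }
  replace (rsum (fun n => pw n p) n) with
    ((2 + q) / q * (q / (2 + q) * rsum (fun n => pw n p) n))%R by (field; lra).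
  replace ((2 + q) / q)%R with ((2 + q) / q * 1)%R at 2 by ring.
  apply Rmult_le_compat_l; auto. apply Rlt_le, Rdiv_lt_0_compat; lra.
Qed.

Lemma pw_0_l p : pw 0 p = 1%R.
Proof.
  unfold pw; simpl; rewrite Rplus_0_l; unfold Rpower.
  now rewrite ln_1, Rmult_0_r, exp_0.
Qed.

Lemma rsum_pw r m : (-1 < r)%R ->
  (rsum (fun n => pw n r) (S m) <= (2 + r) / (1 + r) * pw m (1 + r))%R.
Proof.
  intros Hr. set (q := (1 + r)%R). assert (Hq : (0 < q)%R) by (unfold q; lra).
  replace (2 + r)%R with (1 + q)%R by (unfold q; ring).
  induction m as [|m IH].
  - simpl; rewrite !pw_0_l, Rplus_0_l, Rmult_1_r. apply Rle_div_r; lra.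
  - change (rsum (fun n => pw n r) (S (S m))) with
      (rsum (fun n => pw n r) (S m) + pw (S m) r)%R.
    assert (H := pw_diff_pos q m Hq).
    replace (q - 1)%R with r in H by (unfold q; ring).
    assert (H2 : (pw (S m) r <= (1 + q) / q * (pw (S m) q - pw m q))%R).
    { replace (pw (S m) r) with ((1 + q) / q * (q / (1 + q) * pw (S m) r))%R
        by (field; lra).
      apply Rmult_le_compat_l; auto. apply Rlt_le, Rdiv_lt_0_compat; lra. }
    lra.
Qed.

Lemma pw_lim0 p : (p < 0)%R -> is_lim_seq (fun n => pw n p) 0.
Proof.
  intros Hp. apply lim0_intro; [intros; apply Rlt_le, pw_pos|].
  intros eps He. destruct (INR_unbounded (Rpower eps (/ p))) as [N HN].
  exists N; intros n Hn. apply le_INR in Hn.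
  replace eps with (Rpower (Rpower eps (/ p)) p).
  2:{ rewrite Rpower_mult. replace (/ p * p)%R with 1%R by (field; lra).
      now apply Rpower_1. }
  assert (P : (0 < Rpower eps (/ p))%R) by apply exp_pos.
  unfold pw, Rpower at 1 2.
  assert (H : (ln (Rpower eps (/ p)) < ln (INR n + 1))%R) by (apply ln_increasing; lra).
  left; apply exp_increasing. nra.
Qed.

(** * The complex exponential exp (x + iy) near 0 *)

Definition cE (x y : R) : C := RtoC (exp x) * (cos y, sin y).

Lemma cE_plus x x' y y' : cE (x + x') (y + y') = cE x y * cE x' y'.
Proof.
  unfold cE. rewrite exp_plus, cos_plus, sin_plus.
  apply injective_projections; simpl; ring.
Qed.

Lemma Cmod_cE x y : Cmod (cE x y) = exp x.
Proof.
  unfold cE. rewrite Cmod_mult, Cmod_R, Rabs_pos_eq by apply Rlt_le, exp_pos.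
  unfold Cmod; simpl.
  replace (_ + _)%R with 1%R.
  - rewrite sqrt_1; ring.
  - generalize (sin2_cos2 y); unfold Rsqr; lra.
Qed.

Lemma sin_abs_le y : (Rabs y <= 1)%R -> (Rabs (sin y) <= Rabs y)%R.
Proof.
  assert (H : forall t, (0 < t <= 1 -> Rabs (sin t) <= t)%R).
  { intros t Ht. rewrite Rabs_pos_eq.
    - left; now apply sin_lt_x.
    - apply sin_ge_0; [lra|]. generalize PI2_3_2; lra. }
  intros Hy. destruct (Rtotal_order y 0) as [L|[->|G]].
  - rewrite (Rabs_left y) in * by easy.
    rewrite <- (Rabs_Ropp (sin y)), <- sin_neg. apply H; lra.
  - rewrite sin_0; lra.
  - rewrite (Rabs_pos_eq y) in * by lra. apply H; lra.
Qed.

Lemma cos_bound_sq y : (Rabs y <= 1)%R -> (0 <= 1 - cos y <= y ^ 2 / 2)%R.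
Proof.
  intros Hy. replace y with (2 * (y / 2))%R at 1 2 by field.
  rewrite cos_2a_sin.
  assert (A := sin_abs_le (y / 2)). 
  assert (B : (Rabs (y / 2) = Rabs y / 2)%R).
  { unfold Rdiv; rewrite Rabs_mult, (Rabs_pos_eq (/ 2)); lra. }
  rewrite B in A. specialize (A ltac:(lra)).
  assert (D : (sin (y / 2) * sin (y / 2) = Rabs (sin (y / 2)) * Rabs (sin (y / 2)))%R)
    by (rewrite <- Rabs_mult, Rabs_pos_eq; nra).
  assert (F : (y ^ 2 = Rabs y * Rabs y)%R)
    by (rewrite <- Rabs_mult, Rabs_pos_eq; nra).
  generalize (Rabs_pos (sin (y / 2))) (Rabs_pos y). intros.
  split; nra.
Qed.

Lemma sin_sub_id y : (Rabs y <= 1)%R -> (Rabs (sin y - y) <= y ^ 2)%R.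
Proof.
  assert (H : forall t, (0 < t <= 1 -> 0 <= t - sin t <= t ^ 2)%R).
  { intros t Ht.
    destruct (MVT_cor2 (fun x => x - sin x)%R (fun x => 1 - cos x)%R 0 t)
      as [c [E Hc]]; [lra| |].
    - intros c _. apply derivable_pt_lim_minus.
      + apply derivable_pt_lim_id.
      + apply derivable_pt_lim_sin.
    - rewrite sin_0 in E. destruct (cos_bound_sq c); [rewrite Rabs_pos_eq; lra|].
      nra. }
  intros Hy. destruct (Rtotal_order y 0) as [L|[->|G]].
  - rewrite Rabs_left in Hy by easy. specialize (H (- y)%R ltac:(lra)).
    rewrite sin_neg in H. apply Rabs_le; nra.
  - rewrite sin_0, Rminus_0_r, Rabs_R0; simpl; lra.
  - rewrite Rabs_pos_eq in Hy by lra. specialize (H y ltac:(lra)).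
    apply Rabs_le; nra.
Qed.

Lemma exp_sub_id x : (Rabs x <= 1 / 2)%R -> (0 <= exp x - 1 - x <= 2 * x ^ 2)%R.
Proof.
  intros Hx. apply Rabs_le_between in Hx.
  split; [generalize (exp_ineq1_le x); lra|].
  (* From exp (-x) >= 1-x follows exp x (1-x) <= 1, hence (exp x - 1 - x)(1-x) <= x^2, where 1-x >=
     1/2. *)
  assert (H := exp_ineq1_le (- x)). rewrite exp_Ropp in H.
  assert (P := exp_pos x).
  assert (H2 : (exp x * (1 - x) <= 1)%R).
  { replace 1%R with (exp x * / exp x)%R at 2 by (field; lra).
    apply Rmult_le_compat_l; lra. }
  assert (Q : (0 <= x ^ 2)%R) by nra.
  assert ((exp x - 1 - x) * (1 - x) <= x ^ 2)%R by nra.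
  nra.
Qed.

(** The Taylor remainder of second order; the constant 10 is generous. *)
Lemma cE_bound x y : (Rabs x <= 1 / 2)%R -> (Rabs y <= 1 / 2)%R ->
  (Cmod (cE x y - (1 + (x, y))) <= 10 * Cmod (x, y) ^ 2)%R.
Proof.
  intros Hx Hy.
  replace (Cmod (x, y) ^ 2)%R with (x ^ 2 + y ^ 2)%R.
  2:{ unfold Cmod; simpl fst; simpl snd. rewrite pow2_sqrt; [easy|nra]. }
  eapply Rle_trans; [apply Cmod_le_re_im|]. unfold Re, Im, cE; simpl fst; simpl snd.
  destruct (exp_sub_id x Hx) as [A1 A2].
  destruct (cos_bound_sq y) as [B1 B2]; [lra|].
  assert (D := sin_sub_id y ltac:(lra)).
  apply Rabs_le_between in Hx, Hy, D.
  assert (P := exp_pos x).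
  assert (X2 : (exp x <= 2)%R) by nra.
  set (e := exp x) in *; set (co := cos y) in *; set (si := sin y) in *.
  apply Rle_trans with ((2 * x ^ 2 + y ^ 2) + (3 * y ^ 2 + x ^ 2))%R; [|nra].
  apply Rplus_le_compat; apply Rabs_le.
  - replace (e * co - 0 * si + - (1 + x))%R with ((e - 1 - x) - e * (1 - co))%R by ring.
    split; nra.
  - replace (e * si + 0 * co + - (0 + y))%R with (e * (si - y) + (e - 1) * y)%R by ring.
    assert (U : (- (2 * y ^ 2) <= e * (si - y) <= 2 * y ^ 2)%R) by (split; nra).
    assert (V2 : (- (x ^ 2 / 2 + y ^ 2 / 2) <= x * y <= x ^ 2 / 2 + y ^ 2 / 2)%R)
      by (generalize (pow2_ge_0 (x + y)) (pow2_ge_0 (x - y)); split; nra).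
    assert (V3 : ((e - 1 - x) * (e - 1 - x) <= x ^ 2)%R).
    { assert (X4 : (x ^ 2 <= 1 / 4)%R) by nra.
      apply Rle_trans with ((2 * x ^ 2) * (2 * x ^ 2))%R; [|nra].
      apply Rmult_le_compat; auto. }
    assert (V4 : (- (y ^ 2 / 2 + x ^ 2 / 2) <= (e - 1 - x) * y <= (y ^ 2 / 2 + x ^ 2 / 2))%R)
      by (generalize (pow2_ge_0 (e - 1 - x + y)) (pow2_ge_0 (e - 1 - x - y)); split; nra).
    replace ((e - 1) * y)%R with ((e - 1 - x) * y + x * y)%R by ring.
    split; nra.
Qed.

(** * The Gamma function and growth of Pochhammer symbols *)


Definition gamma_seq (z : C) (k : nat) : C :=
  INR (fact k) * RCpower (INR k) (z - 1) / poch z k.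

Lemma RCpower_cE x z : RCpower x z = cE (Re z * ln x) (Im z * ln x).
Proof. reflexivity. Qed.

Lemma Cmod_ge_sub (x y : C) : (Cmod x - Cmod y <= Cmod (x + y))%R.
Proof.
  generalize (Cmod_triangle (x + y) (- y)). rewrite Cmod_opp.
  replace (x + y + - y) with x by ring. lra.
Qed.

(** The quotient of successive terms of [gamma_seq] is (k+1)(1+1/k)^w / (z+k) with w = z-1. Here
    (1+1/k)^w = 1 + wL + O(L^2), and (k+1)(1+wL) - (z+k) = w((k+1)L - 1), where (k+1)L - 1 lies
    between 0 and 1/k. The first-order terms thus cancel and the deviation from 1 is O(1/k^2). *)
Lemma gamma_ratio_bound z k : (1 <= k)%nat -> (2 * Cmod z <= INR k)%R ->
  (2 * Cmod (z - 1) <= INR k)%R -> z + INR k <> 0 ->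
  let L := (ln (INR k + 1) - ln (INR k))%R in
  (Cmod ((INR k + 1) * cE (Re (z - 1) * L) (Im (z - 1) * L) / (z + INR k) - 1) <=
   (40 * Cmod (z - 1) ^ 2 + 2 * Cmod (z - 1)) / INR k ^ 2)%R.
Proof.
  intros Hk Hz Hw Hzk L.
  apply le_INR in Hk; simpl in Hk. set (x := INR k) in *.
  set (w := z - 1) in *. 
  assert (L1 : (/ (x + 1) <= L)%R).
  { unfold L. eapply Rle_trans; [|apply ln_diff_lower; lra].
    right; field; lra. }
  assert (L2 : (L <= / x)%R).
  { unfold L. generalize (ln_diff_lower (x + 1) x ltac:(lra) ltac:(lra)).
    replace (1 - (x + 1) / x)%R with (- / x)%R by (field; lra). lra. }
  assert (L0 : (0 <= L)%R).
  { eapply Rle_trans; [|apply L1]. apply Rlt_le, Rinv_0_lt_compat; lra. }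
  assert (Hx : (0 < / x)%R) by (apply Rinv_0_lt_compat; lra).
  assert (Hxx : (x * / x = 1)%R) by (field; lra).
  set (m := Cmod w) in *. assert (Hm : (0 <= m)%R) by apply Cmod_ge_0.
  assert (HmL : (m * L <= 1 / 2)%R).
  { apply Rle_trans with (x / 2 * / x)%R; [|right; field; lra].
    apply Rmult_le_compat; lra. }
  set (X := (Re w * L, Im w * L)%R : C).
  assert (EX : X = w * L).
  { unfold X, Re, Im; apply injective_projections; simpl; ring. }
  assert (CX : Cmod X = (m * L)%R).
  { rewrite EX, Cmod_mult, Cmod_R, Rabs_pos_eq by easy. reflexivity. }
  assert (B : (Cmod (cE (Re w * L) (Im w * L) - (1 + X)) <= 10 * Cmod X ^ 2)%R).
  { apply cE_bound; [generalize (re_le_Cmod X)|generalize (im_le_Cmod X)];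
      rewrite CX; unfold Re, Im, X; simpl; lra. }
  set (E := cE _ _) in *.
  replace ((x + 1) * E / (z + x) - 1) with
    (((x + 1) * (E - (1 + X)) + w * ((x + 1) * L - 1)) / (z + x)).
  2:{ rewrite EX. unfold w. field; auto. }
  rewrite Cmod_div by auto.
  assert (Z : (x / 2 <= Cmod (z + x))%R).
  { replace (z + x) with (x + z) by ring.
    generalize (Cmod_ge_sub x z). rewrite Cmod_R, Rabs_pos_eq; lra. }
  assert (N : (Cmod ((x + 1) * (E - (1 + X)) + w * ((x + 1) * L - 1)) <=
      (20 * m ^ 2 + m) * / x)%R).
  { eapply Rle_trans; [apply Cmod_triangle|]. rewrite !Cmod_mult.
    replace (x + 1) with (RtoC (x + 1)) by now rewrite RtoC_plus.
    replace (RtoC (x + 1) * L - 1) with (RtoC ((x + 1) * L - 1))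
      by now rewrite RtoC_minus, RtoC_mult.
    rewrite !Cmod_R. rewrite (Rabs_pos_eq (x + 1)) by lra.
    assert (D1 : ((x + 1) * L <= 1 + / x)%R).
    { apply Rle_trans with ((x + 1) * / x)%R; [|right; field; lra].
      apply Rmult_le_compat_l; lra. }
    assert (D2 : (1 <= (x + 1) * L)%R).
    { apply Rle_trans with ((x + 1) * / (x + 1))%R; [right; field; lra|].
      apply Rmult_le_compat_l; lra. }
    rewrite Rabs_pos_eq by lra. fold m.
    assert (D3 : (10 * Cmod X ^ 2 <= 10 * m ^ 2 * (/ x * / x))%R).
    { rewrite CX. replace (10 * (m * L) ^ 2)%R with (10 * m ^ 2 * (L * L))%R by ring.
      apply Rmult_le_compat_l; [nra|]. apply Rmult_le_compat; auto. }
    apply Rle_trans with ((x + 1) * (10 * m ^ 2 * (/ x * / x)) + m * / x)%R.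
    - apply Rplus_le_compat.
      + apply Rmult_le_compat_l; lra.
      + apply Rmult_le_compat_l; lra.
    - assert (D4 : ((x + 1) * (/ x * / x) <= 2 * / x)%R).
      { replace ((x + 1) * (/ x * / x))%R with ((1 + / x) * / x)%R by (field; lra).
        apply Rmult_le_compat_r; [lra|].
        assert (/ x <= 1)%R by (rewrite <- Rinv_1; apply Rinv_le_contravar; lra). lra. }
      assert (Q : (0 <= m ^ 2)%R) by nra. nra. }
  apply Rle_div_l; [lra|].
  apply Rle_trans with (1 := N).
  apply Rle_trans with ((40 * m ^ 2 + 2 * m) / x ^ 2 * (x / 2))%R.
  - right; field; lra.
  - apply Rmult_le_compat_l; auto. apply Rlt_le in Hx.
    unfold Rdiv; apply Rmult_le_pos; [nra|].
    apply Rlt_le, Rinv_0_lt_compat; nra.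
Qed.

Lemma gamma_seq_step z k : ~ nonpos_int z -> (1 <= k)%nat ->
  let L := (ln (INR k + 1) - ln (INR k))%R in
  gamma_seq z (S k) = gamma_seq z k *
    ((INR k + 1) * cE (Re (z - 1) * L) (Im (z - 1) * L) / (z + INR k)).
Proof.
  intros Hz Hk L. unfold gamma_seq. rewrite !RCpower_cE.
  replace (cE (Re (z - 1) * ln (INR (S k))) (Im (z - 1) * ln (INR (S k))))
    with (cE (Re (z - 1) * ln (INR k)) (Im (z - 1) * ln (INR k))
          * cE (Re (z - 1) * L) (Im (z - 1) * L)).
  2:{ rewrite <- cE_plus, S_INR. unfold L. f_equal; ring. }
  change (fact (S k)) with (S k * fact k)%nat.
  rewrite mult_INR, RtoC_mult, INR_S. simpl poch.
  assert (P1 := poch_neq0 z k Hz). assert (P2 := nonpos_shift_neq0 z k Hz).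
  field; auto.
Qed.

Lemma gamma_seq_neq0 z k : ~ nonpos_int z -> gamma_seq z k <> 0.
Proof.
  intros Hz. unfold gamma_seq, Cdiv. apply Cmult_neq_0; [apply Cmult_neq_0|].
  - apply INR_neq, fact_neq_0.
  - apply Cmod_gt_0. rewrite RCpower_cE, Cmod_cE. apply exp_pos.
  - assert (P := poch_neq0 z k Hz). intros E. apply C1_nz.
    rewrite <- (Cinv_r _ P), E; ring.
Qed.

Lemma bsum_inv_sq : bsum (fun n => / (INR n + 1) ^ 2)%R.
Proof.
  apply bsum_le with (fun n => pw n (- (2))) O.
  - intros n _. right. unfold pw. rewrite Rpower_Ropp. f_equal.
    rewrite <- Rpower_pow by (generalize (pos_INR n); lra). reflexivity.
  - intros n; apply Rlt_le, pw_pos.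
  - intros n; apply Rlt_le, Rinv_0_lt_compat. generalize (pos_INR n); nra.
  - apply bsum_pw; lra.
Qed.

Lemma gamma_seq_cv z : ~ nonpos_int z -> exists l : C, l <> 0 /\ Ccv (gamma_seq z) l.
Proof.
  intros Hz.
  set (K := (40 * Cmod (z - 1) ^ 2 + 2 * Cmod (z - 1))%R).
  assert (M1 := Cmod_ge_0 z). assert (M2 := Cmod_ge_0 (z - 1)).
  assert (HK : (0 <= K)%R) by (unfold K; nra).
  (* Dropping the first N factors secures the conditions of [gamma_ratio_bound] and K / k^2 <= 1/2,
     as required by [Ccv_prod_nonzero]. *)
  destruct (INR_unbounded (2 * K + 2 * Cmod z + 2 * Cmod (z - 1) + 1)) as [N HN].
  set (L := fun k : nat => (ln (INR k + 1) - ln (INR k))%R).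
  assert (HI : forall n, INR (n + N) = (INR n + INR N)%R) by (intros; apply plus_INR).
  assert (HP := pos_INR).
  destruct (Ccv_prod_nonzero (fun n => gamma_seq z (n + N))
    (fun n => (INR (n + N) + 1) * cE (Re (z - 1) * L (n + N)%nat)
               (Im (z - 1) * L (n + N)%nat) / (z + INR (n + N)))
    (fun n => K / INR (n + N) ^ 2)%R) as [l [Hl1 Hl2]].
  - intros n. simpl Nat.add. apply gamma_seq_step; auto.
    apply INR_le. rewrite HI; simpl. specialize (HP n). lra.
  - intros n. apply gamma_ratio_bound.
    + apply INR_le. rewrite HI; simpl. specialize (HP n). lra.
    + rewrite HI; specialize (HP n); lra.
    + rewrite HI; specialize (HP n); lra.
    + now apply nonpos_shift_neq0.
  - intros n. rewrite HI; specialize (HP n). apply Rle_div_l; nra.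
  - apply bsum_le with (fun n => K * / (INR n + 1) ^ 2)%R O.
    + intros n _. unfold Rdiv; apply Rmult_le_compat_l; auto.
      rewrite HI; specialize (HP n). apply Rinv_le_contravar; nra.
    + intros n; apply Rmult_le_pos; auto.
      apply Rlt_le, Rinv_0_lt_compat. specialize (HP n); nra.
    + intros n; unfold Rdiv; apply Rmult_le_pos; auto.
      apply Rlt_le, Rinv_0_lt_compat. rewrite HI. specialize (HP n); nra.
    + apply bsum_scal; auto using bsum_inv_sq.
  - now apply gamma_seq_neq0.
  - exists l; split; auto. now apply Ccv_subseq_inv with N.
Qed.

Lemma CLim_seq_eq u l : Ccv u l -> CLim_seq u = l.
Proof.
  intros [H1 H2]. unfold CLim_seq.
  rewrite (is_lim_seq_unique _ _ H1), (is_lim_seq_unique _ _ H2).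
  now destruct l.
Qed.

Lemma Gamma_cv z : ~ nonpos_int z -> Gamma z <> 0 /\ Ccv (gamma_seq z) (Gamma z).
Proof.
  intros Hz; destruct (gamma_seq_cv z Hz) as [l [H1 H2]].
  replace (Gamma z) with l; auto. symmetry; now apply CLim_seq_eq.
Qed.

(** Descending from N, each exceptional index is absorbed into the constant, because [g] is
    positive. *)
Lemma eventually_bound (f g : nat -> R) :
  (forall n, (0 < g n)%R) ->
  (exists D N, forall n, (N <= n)%nat -> (f n <= D * g n)%R) ->
  exists D, (0 < D)%R /\ forall n, (f n <= D * g n)%R.
Proof.
  intros Hg [D [N H]]. revert D H; induction N as [|N IH]; intros D H.
  - exists (Rabs D + 1)%R; split; [generalize (Rabs_pos D); lra|].
    intros n; specialize (H n (Nat.le_0_l n)). specialize (Hg n).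
    generalize (Rle_abs D); nra.
  - apply (IH (Rmax D (f N / g N))). intros n Hn.
    specialize (Hg n). destruct (Nat.eq_dec n N) as [->|Hne].
    + apply Rle_trans with (f N / g N * g N)%R; [right; field; lra|].
      apply Rmult_le_compat_r; [lra|apply Rmax_r].
    + apply Rle_trans with (D * g n)%R; [apply H; lia|].
      apply Rmult_le_compat_r; [lra|apply Rmax_l].
Qed.

(** As ln (n+1) - ln n lies in [0, 1], the powers of n in [gamma_seq] are comparable to the shifted
    powers [pw], for either sign of p. *)
Lemma Rpower_succ_bound n p : (1 <= n)%nat ->
  (Rpower (INR n) p <= exp (Rabs p) * pw n p)%R /\
  (pw n p <= exp (Rabs p) * Rpower (INR n) p)%R.
Proof.
  intros Hn; apply le_INR in Hn; simpl in Hn.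
  assert (L1 : (ln (INR n + 1) - ln (INR n) <= 1)%R).
  { generalize (ln_diff_lower (INR n + 1) (INR n) ltac:(lra) ltac:(lra)).
    replace (1 - (INR n + 1) / INR n)%R with (- / INR n)%R by (field; lra).
    assert (/ INR n <= 1)%R by (rewrite <- Rinv_1; apply Rinv_le_contravar; lra). lra. }
  assert (L2 : (ln (INR n) <= ln (INR n + 1))%R) by (left; apply ln_increasing; lra).
  set (d := (ln (INR n + 1) - ln (INR n))%R) in *.
  assert (A : (- Rabs p <= p * d <= Rabs p)%R).
  { apply Rabs_le_between. rewrite Rabs_mult, (Rabs_pos_eq d) by (unfold d; lra).
    generalize (Rabs_pos p); nra. }
  assert (M : forall x y, (x <= y)%R -> (exp x <= exp y)%R).
  { intros x y [H| ->]; [left; now apply exp_increasing|right; easy]. }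
  unfold pw, Rpower. rewrite <- !exp_plus.
  unfold d in A; split; apply M; lra.
Qed.

Lemma Cmod_gamma_seq z k : ~ nonpos_int z ->
  Cmod (gamma_seq z k) =
  (Cmod (poch 1 k) * Rpower (INR k) (Re z - 1) / Cmod (poch z k))%R.
Proof.
  intros Hz. unfold gamma_seq. rewrite Cmod_div by now apply poch_neq0.
  rewrite Cmod_mult, RCpower_cE, Cmod_cE, poch_1.
  unfold Rpower. replace (Re (z - 1)) with (Re z - 1)%R; [easy|].
  unfold Re; simpl; ring.
Qed.

(** The modulus of [gamma_seq z k] is k! k^(Re z - 1) / |(z)_k|, so this is the boundedness of a
    convergent sequence; the reverse estimate [poch_le] needs in addition that the limit Gamma(z) is
    nonzero. *)
Lemma poch_ge z : ~ nonpos_int z -> exists D, (0 < D)%R /\ forall k,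
  (Cmod (poch 1 k) * pw k (Re z - 1) <= D * Cmod (poch z k))%R.
Proof.
  intros Hz. apply eventually_bound.
  { intros; now apply Cmod_gt_0, poch_neq0. }
  destruct (Gamma_cv z Hz) as [_ H]. apply Ccv_Cmod_lim, lim_bounded in H.
  destruct H as [M HM].
  exists (exp (Rabs (Re z - 1)) * M)%R, 1%nat; intros k Hk.
  specialize (HM k). rewrite Cmod_gamma_seq in HM by easy.
  assert (P : (0 < Cmod (poch z k))%R) by now apply Cmod_gt_0, poch_neq0.
  apply Rle_div_l in HM; [|easy].
  destruct (Rpower_succ_bound k (Re z - 1) Hk) as [_ B].
  generalize (Cmod_ge_0 (poch 1 k)) (exp_pos (Rabs (Re z - 1))). intros.
  set (e := exp _) in *. set (q := Rpower _ _) in *. nra.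
Qed.

Lemma poch_nonpos n k : (n < k)%nat -> poch (- INR n) k = 0.
Proof.
  intros H. replace k with (S n + (k - S n))%nat by lia.
  rewrite poch_add, poch_neg; ring.
Qed.

Lemma poch_le z : exists D, (0 < D)%R /\ forall k,
  (Cmod (poch z k) <= D * (Cmod (poch 1 k) * pw k (Re z - 1)))%R.
Proof.
  apply eventually_bound.
  { intros n; apply Rmult_lt_0_compat; [|apply pw_pos].
    apply Cmod_gt_0, poch_neq0, nonpos_1. }
  destruct (Classical_Prop.classic (nonpos_int z)) as [[n ->]|Hz].
  (* For z = -n the Pochhammer symbols vanish from n+1 on, so the constant 0 serves eventually. *)
  { exists 0%R, (S n); intros k Hk. rewrite poch_nonpos by lia.
    rewrite Cmod_0; lra. }
  destruct (Gamma_cv z Hz) as [G H]. apply Ccv_Cmod in H.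
  apply Cmod_gt_0 in G. set (g := Cmod (Gamma z)) in *.
  destruct (lim0_spec _ H (g / 2)) as [N HN]; [lra|].
  exists (2 / g * exp (Rabs (Re z - 1)))%R, (S N); intros k Hk.
  specialize (HN k ltac:(lia)).
  assert (B := Cmod_ge_sub (Gamma z) (gamma_seq z k - Gamma z)).
  replace (Gamma z + (gamma_seq z k - Gamma z)) with (gamma_seq z k) in B by ring.
  fold g in B. rewrite Cmod_gamma_seq in B by easy.
  assert (P : (0 < Cmod (poch z k))%R) by now apply Cmod_gt_0, poch_neq0.
  assert (B2 : (g / 2 <= Cmod (poch 1 k) * Rpower (INR k) (Re z - 1) /
                 Cmod (poch z k))%R) by lra.
  apply Rle_div_r in B2; [|easy].
  destruct (Rpower_succ_bound k (Re z - 1) ltac:(lia)) as [B3 _].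
  apply Rle_trans with (2 / g * (g / 2 * Cmod (poch z k)))%R; [right; field; lra|].
  rewrite Rmult_assoc. apply Rmult_le_compat_l.
  { apply Rlt_le, Rdiv_lt_0_compat; lra. }
  apply Rle_trans with (1 := B2).
  generalize (Cmod_ge_0 (poch 1 k)); intros.
  set (e := exp _) in *. set (q := Rpower _ _) in *. nra.
Qed.

(** * Limit theorems for weighted series *)


Lemma Ccv_is_series u l : Ccv (csum u) l ->
  @is_series C_AbsRing C_NormedModule u l.
Proof.
  (* [sum_n u n] includes the index n, whereas [csum u n] stops before it. *)
  intros H. assert (E : forall n, sum_n u n = csum u (S n)).
  { induction n as [|n IH].
    - rewrite sum_O; simpl; ring.
    - rewrite sum_Sn, IH; reflexivity. }
  apply (filterlim_ext (fun n => csum u (S n))); [intros; now rewrite E|].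
  apply (filterlim_locally_ball_norm (K := C_AbsRing) (U := C_NormedModule)).
  intros [eps He].
  apply Ccv_Cmod in H. destruct (lim0_spec _ H eps He) as [N HN].
  exists N; intros n Hn. apply (HN (S n)). lia.
Qed.

Lemma Ccv_CSeries u l : Ccv (csum u) l -> CSeries u = l.
Proof.
  intros H. assert (H2 := Ccv_subseq _ _ 1 H). destruct H2 as [H1 H2].
  unfold CSeries. rewrite (is_series_unique _ (Re l)), (is_series_unique _ (Im l)).
  - now destruct l.
  - change (is_lim_seq (sum_n (fun n => Im (u n))) (Im l)).
    eapply is_lim_seq_ext; [|exact H2]. intros n; cbv beta. rewrite Nat.add_1_r.
    induction n as [|n IH]; [rewrite sum_O; unfold Re, Im; simpl; ring|].
    rewrite sum_Sn, <- IH. reflexivity.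
  - change (is_lim_seq (sum_n (fun n => Re (u n))) (Re l)).
    eapply is_lim_seq_ext; [|exact H1]. intros n; cbv beta. rewrite Nat.add_1_r.
    induction n as [|n IH]; [rewrite sum_O; unfold Re, Im; simpl; ring|].
    rewrite sum_Sn, <- IH. reflexivity.
Qed.

Lemma Ccv_inv u (l : C) : l <> 0 -> Ccv u l -> Ccv (fun n => / u n) (/ l).
Proof.
  intros Hl H. assert (H' := Ccv_Cmod_lim _ _ H).
  apply Cmod_gt_0 in Hl.
  assert (Q : forall v x, is_lim_seq v (Finite x) ->
            is_lim_seq (fun n => v n ^ 2)%R (x ^ 2)%R).
  { intros v x Hv; simpl.
    apply (is_lim_seq_mult' v (fun n => v n * 1)%R); auto.
    apply (is_lim_seq_mult' v (fun _ => 1%R)); auto using is_lim_seq_const. }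
  assert (S : is_lim_seq (fun n => fst (u n) ^ 2 + snd (u n) ^ 2)%R
                (fst l ^ 2 + snd l ^ 2)%R).
  { destruct H as [H1 H2]. apply is_lim_seq_plus'; apply Q; [exact H1|exact H2]. }
  assert (P : (fst l ^ 2 + snd l ^ 2)%R <> 0%R).
  { intros E. unfold Cmod in Hl. rewrite E, sqrt_0 in Hl; lra. }
  destruct H as [H1 H2]. split; unfold Re, Im; simpl fst; simpl snd.
  - now apply is_lim_seq_div'.
  - apply is_lim_seq_div'; auto. now apply (is_lim_seq_opp _ (Finite (snd l))).
Qed.

(** That is, f n = 1 + O(1/n), the behaviour of a quotient of successive hypergeometric terms. *)
Definition near1 (f : nat -> C) : Prop := exists D N, forall n, (N <= n)%nat ->
  (Cmod (f n - 1) <= D * / (INR n + 1))%R.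

Lemma inv_succ_bounds n : (0 < / (INR n + 1) <= 1)%R.
Proof.
  generalize (pos_INR n); intros; split; [apply Rinv_0_lt_compat; lra|].
  rewrite <- Rinv_1; apply Rinv_le_contravar; lra.
Qed.

Lemma near1_ratio u v : near1 (fun n => (u + INR n) / (v + INR n)).
Proof.
  destruct (INR_unbounded (2 * Cmod v + 1)) as [N HN].
  exists (4 * Cmod (u - v))%R, N; intros n Hn. apply le_INR in Hn.
  assert (V0 := Cmod_ge_0 v).
  assert (V : ((INR n + 1) / 4 <= Cmod (v + INR n))%R).
  { replace (v + INR n) with (INR n + v) by ring.
    generalize (Cmod_ge_sub (INR n) v). rewrite Cmod_R, Rabs_pos_eq by apply pos_INR.
    lra. }
  assert (V1 : v + INR n <> 0) by (apply Cmod_gt_0; lra).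
  replace ((u + INR n) / (v + INR n) - 1) with ((u - v) / (v + INR n)) by (field; auto).
  rewrite Cmod_div by auto. apply Rle_div_l; [lra|].
  apply Rle_trans with (4 * Cmod (u - v) * / (INR n + 1) * ((INR n + 1) / 4))%R.
  - right; field; lra.
  - apply Rmult_le_compat_l; auto. generalize (Cmod_ge_0 (u - v)) (inv_succ_bounds n).
    intros; apply Rmult_le_pos; lra.
Qed.

Lemma near1_mult f g : near1 f -> near1 g -> near1 (fun n => f n * g n).
Proof.
  intros [D [N H]] [D' [N' H']].
  exists (Rabs D + Rabs D' + Rabs D * Rabs D')%R, (max N N'); intros n Hn.
  specialize (H n ltac:(lia)). specialize (H' n ltac:(lia)).
  assert (I := inv_succ_bounds n). set (i := (/ (INR n + 1))%R) in *.
  replace (f n * g n - 1) with ((f n - 1) + (g n - 1) + (f n - 1) * (g n - 1)) by ring.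
  eapply Rle_trans; [apply Cmod_triangle|].
  assert (A := Cmod_triangle (f n - 1) (g n - 1)). rewrite Cmod_mult.
  assert (X := Cmod_ge_0 (f n - 1)). assert (Y := Cmod_ge_0 (g n - 1)).
  set (x := Cmod (f n - 1)) in *. set (y := Cmod (g n - 1)) in *.
  assert (H1 : (x <= Rabs D * i)%R) by (generalize (Rle_abs D); nra).
  assert (H2 : (y <= Rabs D' * i)%R) by (generalize (Rle_abs D'); nra).
  assert (H3 : (x * y <= (Rabs D * i) * (Rabs D' * i))%R)
    by (apply Rmult_le_compat; auto).
  generalize (Rabs_pos D) (Rabs_pos D'); intros P P'.
  assert (Q : (0 <= Rabs D * Rabs D')%R) by nra.
  assert ((Rabs D * i) * (Rabs D' * i) <= Rabs D * Rabs D' * i)%R.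
  { replace ((Rabs D * i) * (Rabs D' * i))%R with (Rabs D * Rabs D' * (i * i))%R by ring.
    apply Rmult_le_compat_l; nra. }
  lra.
Qed.

Lemma near1_cv f : near1 f -> Ccv f 1.
Proof.
  intros [D [N H]]. apply (Ccv_subseq_inv f 1 N), Ccv_Cmod.
  apply lim0_squeeze with (fun n => Rabs D * pw n (- (1)))%R.
  - intros n; split; [apply Cmod_ge_0|].
    eapply Rle_trans; [apply H; lia|].
    assert (E : pw n (- (1)) = (/ (INR n + 1))%R).
    { unfold pw. rewrite Rpower_Ropp, Rpower_1; auto. generalize (pos_INR n); lra. }
    rewrite E. apply Rle_trans with (Rabs D * / (INR (n + N) + 1))%R.
    + apply Rmult_le_compat_r; [apply Rlt_le, inv_succ_bounds|apply Rle_abs].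
    + apply Rmult_le_compat_l; [apply Rabs_pos|].
      generalize (pos_INR n) (pos_INR N); intros.
      apply Rinv_le_contravar; rewrite ?plus_INR; lra.
  - replace 0%R with (Rabs D * 0)%R by ring.
    apply is_lim_seq_mult'; [apply is_lim_seq_const|apply pw_lim0; lra].
Qed.

Lemma csum_by_parts t w M :
  csum (fun n => t n * w n) M =
  csum (fun n => csum t (S n) * (w n - w (S n))) M + csum t M * w M.
Proof. induction M as [|M IH]; simpl; [ring|rewrite IH; simpl; ring]. Qed.

(** A Toeplitz argument. With w m 0 = 1 and w m (m+1) = 0 the increments of the weights sum to 1, so
    summation by parts writes the error as a sum of (partial sum - T) times increments. The last
    hypothesis bounds the variation of the complex weights by a telescoping sum of moduli. *)
Lemma regular_summation t T (w : nat -> nat -> C) j0 :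
  Ccv (csum t) T -> (forall m, w m O = 1) -> (forall m, w m (S m) = 0) ->
  (forall n, Ccv (fun m => w m n) 1) ->
  (forall m n, (j0 <= n <= m)%nat ->
     (Cmod (w m n - w m (S n)) <= 2 * (Cmod (w m n) - Cmod (w m (S n))))%R) ->
  Ccv (fun m => csum (fun n => t n * w m n) (S m)) T.
Proof.
  intros Ht Hw0 Hwm Hw Hd. apply Ccv_Cmod.
  set (f := fun m n => (Cmod (csum t (S n) - T) * Cmod (w m n - w m (S n)))%R).
  apply lim0_squeeze with (fun m => rsum (f m) (S m)).
  { intros m; split; [apply Cmod_ge_0|].
    rewrite (csum_by_parts t (w m)), Hwm, Cmult_0_r, Cplus_0_r.
    replace (csum _ (S m) - T) with
      (csum (fun n => (csum t (S n) - T) * (w m n - w m (S n))) (S m)).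
    - eapply Rle_trans; [apply Cmod_csum|]. apply rsum_le; intros n _.
      rewrite Cmod_mult. apply Rle_refl.
    - rewrite (csum_ext _ (fun n => csum t (S n) * (w m n - w m (S n))
          + T * (w m (S n) - w m n))) by (intros; ring).
      rewrite csum_plus, csum_scal, csum_telescope, Hwm, Hw0. ring. }
  assert (Hf : forall m n, (0 <= f m n)%R).
  { intros; unfold f; apply Rmult_le_pos; apply Cmod_ge_0. }
  apply rsum_null; auto.
  - intros n. unfold f.
    replace 0%R with (Cmod (csum t (S n) - T) * 0)%R by ring.
    apply is_lim_seq_mult'; [apply is_lim_seq_const|].
    apply is_lim_seq_ext with (fun m => Cmod ((w m n + (-1) * w m (S n)) - 0)).
    { intros m; f_equal; ring. }
    apply (proj1 (Ccv_Cmod _ _)). replace (RtoC 0) with (1 + (-1) * 1) by ring.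
    apply Ccv_plus, Ccv_scal; auto.
  - intros eps He.
    apply Ccv_Cmod in Ht. destruct (lim0_spec _ Ht (eps / 4)%R) as [N1 HN1]; [lra|].
    set (N := max N1 j0).
    assert (H := Ccv_Cmod_lim _ _ (Hw N)).
    assert (H' := H). apply is_lim_seq_spec in H'.
    destruct (H' (mkposreal 1 Rlt_0_1)) as [M1 HM1]. simpl in HM1.
    exists N, (max M1 N); intros m Hm.
    assert (E : (S m = N + (S m - N))%nat) by lia.
    set (k := (S m - N)%nat) in *. rewrite E, rsum_add.
    apply Rplus_le_compat_l.
    (* The variation beyond N telescopes to at most 2 |w m N| < 4, which explains eps/4. *)
    apply Rle_trans with
      (eps / 4 * (2 * (- Cmod (w m (N + k)%nat) - - Cmod (w m (N + 0)%nat))))%R.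
    + rewrite <- (rsum_telescope (fun i => - Cmod (w m (N + i)%nat))%R), <- !rsum_scal.
      apply rsum_le; intros i Hi. unfold f.
      apply Rmult_le_compat; try apply Cmod_ge_0.
      * left; apply HN1; lia.
      * eapply Rle_trans; [apply Hd; lia|].
        replace (N + S i)%nat with (S (N + i)) by lia. lra.
    + specialize (HM1 m ltac:(lia)). rewrite Cmod_1 in HM1. apply Rabs_def2 in HM1.
      rewrite Nat.add_0_r. generalize (Cmod_ge_0 (w m (N + k)%nat)). nra.
Qed.

(** Uniform smallness is asked of the tails of the products, not boundedness of the weights:
    [saal_weight s m k] at k = m grows like m^(1 - Re s), which is unbounded for Re s < 1. *)
Lemma Tannery t T (v : nat -> nat -> C) :
  Ccv (csum t) T -> bsum (fun k => Cmod (t k)) ->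
  (forall k, Ccv (fun m => v m k) 1) ->
  (forall eps, (0 < eps)%R -> exists N0, forall N, (N0 <= N)%nat ->
     exists M, forall m, (M <= m)%nat ->
     (rsum (fun i => Cmod (t (N + i)%nat) * Cmod (v m (N + i)%nat))%R (S m - N) <= eps)%R) ->
  Ccv (fun m => csum (fun k => t k * v m k) (S m)) T.
Proof.
  intros Ht Hb Hv Hd.
  set (f := fun m n => (Cmod (t n) * Cmod (v m n - 1))%R).
  assert (Hf : forall m n, (0 <= f m n)%R).
  { intros; unfold f; apply Rmult_le_pos; apply Cmod_ge_0. }
  assert (Z : Ccv (fun m => csum (fun k => t k * (v m k - 1)) (S m)) 0).
  { apply Ccv_Cmod. apply lim0_squeeze with (fun m => rsum (f m) (S m)).
    - intros m; split; [apply Cmod_ge_0|].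
      replace (csum (fun k => t k * (v m k - 1)) (S m) - 0) with
        (csum (fun k => t k * (v m k - 1)) (S m)) by ring.
      eapply Rle_trans; [apply Cmod_csum|].
      apply rsum_le; intros; unfold f; rewrite Cmod_mult; apply Rle_refl.
    - apply rsum_null; auto.
      + intros n; unfold f. replace 0%R with (Cmod (t n) * 0)%R by ring.
        apply is_lim_seq_mult'; [apply is_lim_seq_const|].
        apply (proj1 (Ccv_Cmod _ _)), Hv.
      + intros eps He. destruct (Hd (eps / 2)%R) as [N0 HN0]; [lra|].
        destruct (bsum_tail _ (fun i => Cmod_ge_0 _) Hb (eps / 2)%R) as [N1 HN1]; [lra|].
        set (N := max N0 N1). destruct (HN0 N ltac:(lia)) as [M HM].
        exists N, (max M N); intros m Hm.
        assert (E : (S m = N + (S m - N))%nat) by lia.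
        specialize (HM m ltac:(lia)).
        set (k := (S m - N)%nat) in *. rewrite E, rsum_add.
        apply Rplus_le_compat_l.
        assert (B : (rsum (fun i => Cmod (t (N + i)%nat)) k <= eps / 2)%R).
        { specialize (HN1 (N + k)%nat ltac:(lia)).
          rewrite (rsum_add _ N) in HN1.
          assert (rsum (fun k => Cmod (t k)) N1 <= rsum (fun k => Cmod (t k)) N)%R;
            [|lra].
          apply rsum_incr; [intros; apply Cmod_ge_0|lia]. }
        apply Rle_trans with (rsum (fun i => Cmod (t (N + i)%nat) +
          Cmod (t (N + i)%nat) * Cmod (v m (N + i)%nat))%R k).
        * apply rsum_le; intros i _; unfold f.
          replace (v m (N + i)%nat - 1) with (v m (N + i)%nat + - (1)) by ring.
          generalize (Cmod_triangle (v m (N + i)%nat) (- (1))).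
          rewrite Cmod_opp, Cmod_1. generalize (Cmod_ge_0 (t (N + i)%nat)). nra.
        * rewrite rsum_plus. lra. }
  replace T with (0 + T) by ring.
  apply Ccv_ext_loc with (fun m => csum (fun k => t k * (v m k - 1)) (S m)
    + csum t (S m)) O.
  { intros m _. rewrite <- csum_plus. apply csum_ext; intros; ring. }
  apply Ccv_plus; auto.
  apply Ccv_ext_loc with (fun m => csum t (m + 1)) O.
  - intros; now rewrite Nat.add_1_r.
  - now apply Ccv_subseq.
Qed.

(** Twice the partial sum is the partial sum of (-1)^n (u n - u (n+1)), which converges absolutely,
    plus u 0 - (-1)^N u N. *)
Lemma alternating_cv u :
  Ccv u 0 -> bsum (fun n => Cmod (u (S n) - u n)) ->
  exists l, Ccv (csum (fun n => (-1) ^ n * u n)) l.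
Proof.
  intros Hu Hb.
  destruct (abs_cv (fun n => (-1) ^ n * (u n - u (S n)))) as [l Hl].
  { apply bsum_le with (fun n => Cmod (u (S n) - u n)) O; auto using Cmod_ge_0.
    intros n _. rewrite Cmod_mult, Cmod_pow.
    replace (Cmod (-1)) with 1%R.
    2:{ rewrite Cmod_R, Rabs_left; lra. }
    rewrite pow1. replace (u n - u (S n)) with (- (u (S n) - u n)) by ring.
    rewrite Cmod_opp. lra. }
  exists (/ 2 * (l + u O + 0)).
  apply Ccv_ext_loc with (fun N => / 2 *
    (csum (fun n => (-1) ^ n * (u n - u (S n))) N + u O + (- (-1) ^ N * u N))) O.
  - intros N _.
    assert (E : csum (fun n => (-1) ^ n * (u n - u (S n))) N =
      2 * csum (fun n => (-1) ^ n * u n) N - u O + (-1) ^ N * u N).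
    { induction N as [|N IH]; [unfold Cpow; simpl; ring|].
      simpl csum. rewrite IH, Cpow_S; ring. }
    rewrite E. field.
  - apply Ccv_scal, Ccv_plus; [apply Ccv_plus; auto using Ccv_const|].
    apply Ccv_Cmod. apply Ccv_Cmod in Hu.
    eapply is_lim_seq_ext; [|exact Hu]. intros n; simpl.
    replace (- (-1) ^ n * u n - 0) with ((-1) ^ n * - u n) by ring.
    rewrite Cmod_mult, Cmod_pow, Cmod_opp.
    replace (Cmod (-1)) with 1%R by (rewrite Cmod_R, Rabs_left; lra).
    rewrite pow1, Rmult_1_l. f_equal; ring.
Qed.

(** * Orders of growth *)

Definition bigO (f : nat -> C) (p : R) : Prop :=
  exists D, (0 <= D)%R /\ forall n, (Cmod (f n) <= D * pw n p)%R.

Lemma bigO_mult f g p q : bigO f p -> bigO g q -> bigO (fun n => f n * g n) (p + q).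
Proof.
  intros [D [D0 H]] [D' [D0' H']]. exists (D * D')%R; split; [nra|].
  intros n. rewrite Cmod_mult, pw_plus.
  replace (D * D' * (pw n p * pw n q))%R with ((D * pw n p) * (D' * pw n q))%R by ring.
  apply Rmult_le_compat; auto using Cmod_ge_0.
Qed.

Lemma bigO_poch z : bigO (fun n => poch z n / poch 1 n) (Re z - 1).
Proof.
  destruct (poch_le z) as [D [D0 H]]. exists D; split; [lra|]. intros n.
  assert (P := poch_neq0 1 n nonpos_1). rewrite Cmod_div by auto.
  apply Cmod_gt_0 in P. apply Rle_div_l; auto.
  specialize (H n). lra.
Qed.

Lemma bigO_poch_inv z : ~ nonpos_int z ->
  bigO (fun n => poch 1 n / poch z n) (1 - Re z).
Proof.
  intros Hz. destruct (poch_ge z Hz) as [D [D0 H]]. exists D; split; [lra|]. intros n.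
  assert (P := poch_neq0 z n Hz). rewrite Cmod_div by auto.
  apply Cmod_gt_0 in P. apply Rle_div_l; auto.
  specialize (H n).
  assert (E : (pw n (Re z - 1) * pw n (1 - Re z) = 1)%R).
  { rewrite <- pw_plus. replace (_ + _)%R with 0%R by ring. apply pw_0. }
  assert (Q := pw_pos n (1 - Re z)).
  apply Rle_trans with
    (Cmod (poch 1 n) * pw n (Re z - 1) * pw n (1 - Re z))%R.
  - rewrite Rmult_assoc, E; lra.
  - nra.
Qed.

Lemma bigO_linear e : bigO (fun n => e + INR n) 1.
Proof.
  exists (Cmod e + 1)%R; split; [generalize (Cmod_ge_0 e); lra|].
  intros n. unfold pw. assert (H := pos_INR n). rewrite Rpower_1 by lra.
  eapply Rle_trans; [apply Cmod_triangle|]. rewrite Cmod_R, Rabs_pos_eq by easy.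
  generalize (Cmod_ge_0 e). nra.
Qed.

Lemma bigO_lim0 f p : (p < 0)%R -> bigO f p -> Ccv f 0.
Proof.
  intros Hp [D [D0 H]]. apply Ccv_Cmod.
  apply lim0_squeeze with (fun n => D * pw n p)%R.
  - intros n; split; [apply Cmod_ge_0|].
    now replace (f n - 0) with (f n) by ring.
  - replace 0%R with (D * 0)%R by ring.
    apply is_lim_seq_mult'; [apply is_lim_seq_const|now apply pw_lim0].
Qed.

Lemma bigO_bsum f p : (p < -1)%R -> bigO f p -> bsum (fun n => Cmod (f n)).
Proof.
  intros Hp [D [D0 H]].
  apply bsum_le with (fun n => D * pw n p)%R O; auto using Cmod_ge_0.
  - intros n; apply Rmult_le_pos; auto. apply Rlt_le, pw_pos.
  - apply bsum_scal; auto using bsum_pw.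
Qed.

(** * The weights of the terminating identity *)


Definition wp_weight (a : C) (m n : nat) : C :=
  (-1) ^ n * (poch (- INR m) n / poch (1 + a + INR m) n).

Lemma wp_weight_S a m n : ~ nonpos_int (1 + a) ->
  wp_weight a m (S n) =
  wp_weight a m n * ((- INR n + INR m) / (1 + a + INR n + INR m)).
Proof.
  intros Ha. unfold wp_weight. simpl poch. rewrite Cpow_S.
  assert (P1 := poch_neq0 _ n (nonpos_shift _ m Ha)).
  assert (P2 := nonpos_shift_neq0 _ n (nonpos_shift _ m Ha)).
  replace (1 + a + INR n + INR m) with (1 + a + INR m + INR n) by ring.
  field; auto.
Qed.

Lemma wp_weight_cv a n : ~ nonpos_int (1 + a) -> Ccv (fun m => wp_weight a m n) 1.
Proof.
  intros Ha; induction n as [|n IH].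
  - apply Ccv_ext_loc with (2 := Ccv_const 1) (N := O).
    intros m _. unfold wp_weight, Cpow; simpl; field.
  - apply Ccv_ext_loc with (fun m =>
      wp_weight a m n * ((- INR n + INR m) / (1 + a + INR n + INR m))) O.
    { intros m _; now rewrite wp_weight_S. }
    replace (RtoC 1) with (1 * 1) by ring.
    apply Ccv_mult; auto. apply near1_cv, near1_ratio.
Qed.

(** Put q = 1+a+n+m and divide by |w|/|q|. The left side becomes |1+a+2n|; the difference of moduli
    becomes |q| - (m-n) >= Re q - (m-n) = Re (1+a+2n). For n > |a| the imaginary part of 1+a+2n is
    at most its real part, whence the factor 2. *)
Lemma wp_weight_diff a : ~ nonpos_int (1 + a) -> exists j0, forall m n,
  (j0 <= n <= m)%nat ->
  (Cmod (wp_weight a m n - wp_weight a m (S n)) <=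
   2 * (Cmod (wp_weight a m n) - Cmod (wp_weight a m (S n))))%R.
Proof.
  intros Ha. destruct (INR_unbounded (Cmod a)) as [j0 Hj].
  exists j0; intros m n [H1 H2]. rewrite wp_weight_S by easy.
  apply le_INR in H1, H2.
  set (w := wp_weight a m n). set (q := 1 + a + INR n + INR m).
  assert (Q0 : q <> 0).
  { unfold q. apply nonpos_shift_neq0; now apply nonpos_shift. }
  replace (w - w * ((- INR n + INR m) / q)) with (w * ((1 + a + 2 * INR n) / q))
    by (unfold q in *; field; auto).
  rewrite !Cmod_mult, !Cmod_div by auto.
  replace (- INR n + INR m) with (RtoC (INR m - INR n))
    by (rewrite RtoC_minus; ring).
  rewrite Cmod_R, Rabs_pos_eq by lra.
  assert (Qp := proj1 (Cmod_gt_0 q) Q0).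
  assert (R1 := re_le_Cmod a). assert (R2 := im_le_Cmod a).
  apply Rabs_le_between in R1. 
  assert (Qr : (1 + Re a + INR n + INR m <= Cmod q)%R).
  { eapply Rle_trans; [apply Rle_abs|]. eapply Rle_trans; [|apply re_le_Cmod].
    right; f_equal; unfold q, Re; simpl; ring. }
  assert (B : (Cmod (1 + a + 2 * INR n) <= 2 * (1 + Re a + 2 * INR n))%R).
  { eapply Rle_trans; [apply Cmod_le_re_im|].
    replace (Re (1 + a + 2 * INR n)) with (1 + Re a + 2 * INR n)%R
      by (unfold Re; simpl; ring).
    replace (Im (1 + a + 2 * INR n)) with (Im a) by (unfold Im; simpl; ring).
    rewrite (Rabs_pos_eq (1 + _ + _)) by lra. lra. }
  set (d := Cmod (1 + a + 2 * INR n)) in *.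
  replace (2 * (Cmod w - Cmod w * ((INR m - INR n) / Cmod q)))%R
    with (Cmod w * (2 * (Cmod q - (INR m - INR n)) / Cmod q))%R by (field; lra).
  apply Rmult_le_compat_l; [apply Cmod_ge_0|].
  unfold Rdiv; apply Rmult_le_compat_r; [apply Rlt_le, Rinv_0_lt_compat; lra|]. lra.
Qed.

(* For k <= m this is (-m)_k / (1-s-m)_k. *)
Definition saal_weight (s : C) (m k : nat) : C :=
  poch s (m - k) / poch 1 (m - k) * (poch 1 m / poch s m).

Lemma saal_weight_cv s k : ~ nonpos_int s -> Ccv (fun m => saal_weight s m k) 1.
Proof.
  intros Hs; assert (H1 := nonpos_1); induction k as [|k IH].
  - apply Ccv_ext_loc with (2 := Ccv_const 1) (N := O).
    intros m _. unfold saal_weight. rewrite Nat.sub_0_r.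
    assert (P1 := poch_neq0 1 m H1). assert (P2 := poch_neq0 s m Hs). field; auto.
  (* The recursion in k holds for m > k; below that the subtraction in [saal_weight] is
     truncated. *)
  - apply Ccv_ext_loc with (fun m =>
      saal_weight s m k * ((- INR k + INR m) / (s - 1 - INR k + INR m))) (S k).
    { intros m Hm. destruct (Nat.le_exists_sub (S k) m Hm) as [j [-> _]].
      unfold saal_weight.
      replace (j + S k - k)%nat with (S j) by lia.
      replace (j + S k - S k)%nat with j by lia.
      assert (P1 := poch_neq0 1 j H1). assert (P2 := poch_neq0 s j Hs).
      assert (P3 := poch_neq0 1 (j + S k) H1). assert (P4 := poch_neq0 s (j + S k) Hs).
      assert (P5 := nonpos_shift_neq0 s j Hs). assert (P6 := nonpos_shift_neq0 1 j H1).
      rewrite plus_INR, INR_S || rewrite plus_INR.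
      rewrite RtoC_plus, INR_S.
      replace (s - 1 - INR k + (INR j + (INR k + 1))) with (s + INR j) by ring.
      simpl poch. field; auto 10. }
    replace (RtoC 1) with (1 * 1) by ring.
    apply Ccv_mult; auto. apply near1_cv, near1_ratio.
Qed.

Lemma re_pos_not_nonpos s : (0 < Re s)%R -> ~ nonpos_int s.
Proof.
  intros Hs [n ->]. unfold Re in Hs; simpl in Hs. generalize (pos_INR n); lra.
Qed.

Lemma saal_weight_bound s : ~ nonpos_int s -> exists D, (0 <= D)%R /\ forall m k,
  (Cmod (saal_weight s m k) <= D * (pw (m - k) (Re s - 1) * pw m (1 - Re s)))%R.
Proof.
  intros Hs. destruct (bigO_poch s) as [D [D0 H]].
  destruct (bigO_poch_inv s Hs) as [D' [D0' H']].
  exists (D * D')%R; split; [nra|]. intros m k. unfold saal_weight.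
  rewrite Cmod_mult.
  replace (D * D' * (pw (m - k) (Re s - 1) * pw m (1 - Re s)))%R
    with ((D * pw (m - k) (Re s - 1)) * (D' * pw m (1 - Re s)))%R by ring.
  apply Rmult_le_compat; auto using Cmod_ge_0.
Qed.

Lemma pw_comparable n m p : (n <= m)%nat -> (m <= 2 * n + 1)%nat ->
  (pw n p <= Rpower 2 (Rabs p) * pw m p)%R.
Proof.
  intros H1 H2. apply le_INR in H1, H2.
  rewrite plus_INR, mult_INR in H2; simpl in H2.
  assert (H0 := pos_INR n).
  unfold pw, Rpower. rewrite <- exp_plus.
  assert (L1 : (0 <= ln (INR m + 1) - ln (INR n + 1))%R).
  { destruct (Req_dec (INR n) (INR m)) as [->|Hne]; [lra|].
    apply Rlt_le, Rlt_0_minus, ln_increasing; lra. }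
  assert (L2 : (ln (INR m + 1) - ln (INR n + 1) <= ln 2)%R).
  { assert (ln (INR m + 1) <= ln (2 * (INR n + 1)))%R.
    { destruct (Req_dec (INR m + 1) (2 * (INR n + 1))) as [->|Hne]; [lra|].
      apply Rlt_le, ln_increasing; lra. }
    rewrite ln_mult in H by lra. lra. }
  assert (A : (- (Rabs p * ln 2) <= p * (ln (INR m + 1) - ln (INR n + 1)))%R).
  { generalize (Rabs_pos p) (Rle_abs (- p)). rewrite Rabs_Ropp. intros. nra. }
  assert (M : forall x y, (x <= y)%R -> (exp x <= exp y)%R).
  { intros x y [H| ->]; [left; now apply exp_increasing|right; easy]. }
  apply M; lra.
Qed.

Lemma rsum_rev f k : rsum (fun i => f (k - i)%nat) (S k) = rsum f (S k).
Proof.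
  induction k as [|k IH]; [reflexivity|].
  change (S (S k)) with (1 + S k)%nat at 1. rewrite rsum_add.
  transitivity (f (S k) + rsum (fun i => f (k - i)%nat) (S k))%R.
  - f_equal; simpl; ring.
  - rewrite IH; apply Rplus_comm.
Qed.

(* For k <= m/2 the ratio (m-k+1)/(m+1) is bounded away from 0; for k > m/2
   it is k+1 that is comparable to m+1. *)
Lemma saal_term_bound r : (0 < r)%R -> exists D, (0 <= D)%R /\
  forall m k, (k <= m)%nat ->
  (pw k (-1 - r) * (pw (m - k) (r - 1) * pw m (1 - r)) <=
   D * (pw k (-1 - r) + pw m (- 2 * r) * pw (m - k) (r - 1)))%R.
Proof.
  intros Hr. set (A := Rpower 2 (Rabs (r - 1))). set (B := Rpower 2 (Rabs (-1 - r))).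
  assert (HA : (0 < A)%R) by apply exp_pos. assert (HB : (0 < B)%R) by apply exp_pos.
  exists (A + B)%R; split; [lra|]. intros m k Hk.
  assert (P1 := pw_pos k (-1 - r)). assert (P2 := pw_pos (m - k) (r - 1)).
  assert (P3 := pw_pos m (1 - r)). assert (P4 := pw_pos m (- 2 * r)).
  destruct (Nat.le_gt_cases (2 * k) m) as [H|H].
  - assert (E : (pw (m - k) (r - 1) <= A * pw m (r - 1))%R)
      by (apply pw_comparable; lia).
    assert (F : (pw m (r - 1) * pw m (1 - r) = 1)%R).
    { rewrite <- pw_plus. replace (_ + _)%R with 0%R by ring. apply pw_0. }
    assert (G : (pw (m - k) (r - 1) * pw m (1 - r) <= A)%R).
    { apply Rle_trans with (A * pw m (r - 1) * pw m (1 - r))%R.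
      - apply Rmult_le_compat_r; lra.
      - rewrite Rmult_assoc, F; lra. }
    assert (0 <= pw m (-2 * r) * pw (m - k) (r - 1))%R by nra.
    set (X := (pw (m - k) (r - 1) * pw m (1 - r))%R) in *.
    set (Y := (pw m (-2 * r) * pw (m - k) (r - 1))%R) in *.
    apply Rle_trans with (pw k (-1 - r) * A)%R; [apply Rmult_le_compat_l; lra|]. nra.
  - assert (E : (pw k (-1 - r) <= B * pw m (-1 - r))%R)
      by (apply pw_comparable; lia).
    assert (F : (pw m (-1 - r) * pw m (1 - r) = pw m (-2 * r))%R).
    { rewrite <- pw_plus. f_equal; ring. }
    apply Rle_trans with (B * pw m (-1 - r) * (pw (m - k) (r - 1) * pw m (1 - r)))%R.
    { apply Rmult_le_compat_r; nra. }
    replace (B * pw m (-1 - r) * (pw (m - k) (r - 1) * pw m (1 - r)))%R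
      with (B * (pw m (-2 * r) * pw (m - k) (r - 1)))%R by (rewrite <- F; ring).
    assert (0 <= pw m (-2 * r) * pw (m - k) (r - 1))%R by nra.
    set (Y := (pw m (-2 * r) * pw (m - k) (r - 1))%R) in *. nra.
Qed.

(** With r = Re s, [saal_term_bound] splits the tail into a tail of the convergent sum of
    (k+1)^(-1-r) and (m+1)^(-2r) times a sum of (j+1)^(r-1). The latter sum is O(m^r), so the second
    part is O(m^(-r)). *)
Lemma saal_sum_cv s t T : (0 < Re s)%R -> bigO t (-1 - Re s) -> Ccv (csum t) T ->
  Ccv (fun m => csum (fun k => t k * saal_weight s m k) (S m)) T.
Proof.
  intros Hs Ht HT. assert (Hn := re_pos_not_nonpos s Hs).
  apply Tannery; auto.
  { apply bigO_bsum with (2 := Ht). lra. }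
  { intros; now apply saal_weight_cv. }
  set (r := Re s) in *.
  destruct Ht as [D1 [D10 H1]].
  destruct (saal_weight_bound s Hn) as [D2 [D20 H2]]. fold r in H2.
  destruct (saal_term_bound r Hs) as [D3 [D30 H3]].
  set (D := (D1 * D2 * D3)%R).
  assert (D0 : (0 <= D)%R) by (unfold D; apply Rmult_le_pos; nra).
  intros eps He.
  (* Each of the two parts is at most e, and D (e + e) = eps D/(D+1) <= eps; D+1 avoids division by
     a vanishing D. *)
  set (e := (eps / (2 * (D + 1)))%R).
  assert (He' : (0 < e)%R) by (apply Rdiv_lt_0_compat; lra).
  destruct (bsum_tail (fun n => pw n (-1 - r)) (fun n => Rlt_le _ _ (pw_pos n _))
    (bsum_pw (-1 - r) ltac:(lra)) e He') as [N0 HN0].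
  set (K := ((2 + (r - 1)) / (1 + (r - 1)))%R).
  assert (HK : (0 <= K)%R) by (apply Rlt_le, Rdiv_lt_0_compat; lra).
  assert (L : is_lim_seq (fun m => K * pw m (- r))%R 0).
  { replace 0%R with (K * 0)%R by ring.
    apply is_lim_seq_mult'; [apply is_lim_seq_const|apply pw_lim0; lra]. }
  destruct (lim0_spec _ L e He') as [M0 HM0].
  exists N0; intros N HN. exists (max N M0); intros m Hm.
  specialize (HM0 m ltac:(lia)).
  replace (S m - N)%nat with (S (m - N)) by lia. set (k := (m - N)%nat).
  apply Rle_trans with (rsum (fun i => D * (pw (N + i) (-1 - r)
     + pw m (- 2 * r) * pw (k - i) (r - 1)))%R (S k)).
  - apply rsum_le; intros i Hi.
    apply Rle_trans with ((D1 * pw (N + i) (-1 - r)) *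
      (D2 * (pw (m - (N + i)) (r - 1) * pw m (1 - r))))%R.
    + apply Rmult_le_compat; auto using Cmod_ge_0.
    + replace (k - i)%nat with (m - (N + i))%nat by lia.
      specialize (H3 m (N + i)%nat ltac:(lia)). unfold D.
      set (Y := (pw (m - (N + i)) (r - 1) * pw m (1 - r))%R) in *.
      replace (D1 * pw (N + i) (-1 - r) * (D2 * Y))%R
        with (D1 * D2 * (pw (N + i) (-1 - r) * Y))%R by ring.
      rewrite (Rmult_assoc (D1 * D2)). apply Rmult_le_compat_l; nra.
  - rewrite rsum_scal, rsum_plus, rsum_scal.
    rewrite (rsum_rev (fun j => pw j (r - 1))).
    assert (B1 : (rsum (fun i => pw (N + i) (-1 - r)) (S k) <= e)%R).
    { specialize (HN0 (N + S k)%nat ltac:(lia)).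
      rewrite (rsum_add _ N) in HN0.
      assert (rsum (fun n => pw n (-1 - r)) N0 <= rsum (fun n => pw n (-1 - r)) N)%R;
        [|lra].
      apply rsum_incr; auto. intros; apply Rlt_le, pw_pos. }
    assert (B2 : (pw m (-2 * r) * rsum (fun j => pw j (r - 1)) (S k) <= e)%R).
    { apply Rle_trans with (pw m (-2 * r) * (K * pw m (1 + (r - 1))))%R.
      - apply Rmult_le_compat_l; [apply Rlt_le, pw_pos|].
        apply Rle_trans with (rsum (fun j => pw j (r - 1)) (S m)).
        + apply rsum_incr; [intros; apply Rlt_le, pw_pos|lia].
        + apply rsum_pw; lra.
      - left; eapply Rle_lt_trans; [|exact HM0]. right.
        replace (- r)%R with (- 2 * r + (1 + (r - 1)))%R by ring.
        rewrite (pw_plus m (- 2 * r)); ring. }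
    apply Rle_trans with (D * (e + e))%R; [apply Rmult_le_compat_l; lra|].
    unfold e. apply Rle_trans with (eps * (D / (D + 1)))%R; [right; field; lra|].
    assert (D / (D + 1) <= 1)%R by (apply Rle_div_l; lra). nra.
Qed.

(** In the quotient of the four Euler-Gauss sequences the factorials cancel, and so do the powers of
    m, since (1+a-c) + (1+a-d) = (1+a) + (1+a-c-d). *)
Lemma Gamma_quotient_cv a c d :
  ~ nonpos_int (1 + a) -> ~ nonpos_int (1 + a - c) -> ~ nonpos_int (1 + a - d) ->
  ~ nonpos_int (1 + a - c - d) ->
  Ccv (fun m => poch (1 + a) m * poch (1 + a - c - d) m /
                (poch (1 + a - c) m * poch (1 + a - d) m))
      (Gamma (1 + a - c) * Gamma (1 + a - d) /
       (Gamma (1 + a) * Gamma (1 + a - c - d))).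
Proof.
  intros Ha Hc Hd Hs.
  destruct (Gamma_cv _ Ha) as [Na Ca]. destruct (Gamma_cv _ Hc) as [Nc Cc].
  destruct (Gamma_cv _ Hd) as [Nd Cd]. destruct (Gamma_cv _ Hs) as [Ns Cs].
  apply Ccv_ext_loc with (fun m => gamma_seq (1 + a - c) m * gamma_seq (1 + a - d) m *
    / (gamma_seq (1 + a) m * gamma_seq (1 + a - c - d) m)) O.
  - intros m _. unfold gamma_seq.
    assert (E : RCpower (INR m) (1 + a - c - 1) * RCpower (INR m) (1 + a - d - 1) =
       RCpower (INR m) (1 + a - 1) * RCpower (INR m) (1 + a - c - d - 1)).
    { rewrite !RCpower_cE, <- !cE_plus. f_equal; unfold Re, Im; simpl; ring. }
    assert (P1 := poch_neq0 _ m Ha). assert (P2 := poch_neq0 _ m Hc).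
    assert (P3 := poch_neq0 _ m Hd). assert (P4 := poch_neq0 _ m Hs).
    assert (F : RtoC (INR (fact m)) <> 0) by apply INR_neq, fact_neq_0.
    assert (Z : forall z, RCpower (INR m) z <> 0).
    { intros z. apply Cmod_gt_0. rewrite RCpower_cE, Cmod_cE. apply exp_pos. }
    assert (Z1 := Z (1 + a - 1)). assert (Z2 := Z (1 + a - c - d - 1)).
    set (x := RCpower (INR m) (1 + a - c - 1)) in *.
    set (y := RCpower (INR m) (1 + a - d - 1)) in *.
    set (z := RCpower (INR m) (1 + a - 1)) in *.
    set (t := RCpower (INR m) (1 + a - c - d - 1)) in *.
    transitivity (x * y / (z * t) * (poch (1 + a) m * poch (1 + a - c - d) m /
                (poch (1 + a - c) m * poch (1 + a - d) m))).
    + field; auto 10.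
    + rewrite E; field; auto.
  - apply Ccv_mult; [now apply Ccv_mult|].
    apply Ccv_inv; [now apply Cmult_neq_0|now apply Ccv_mult].
Qed.

(** * The series of the theorem *)


(** The term without its sign (-1)^n, so that successive terms have a quotient near 1, and with
    (1+e)_n / (e)_n reduced to (e+n)/e. *)
Definition lhs_term (a b c d e : C) (n : nat) : C :=
  poch a n * poch b n * poch c n * poch d n * (e + INR n) /
  (e * (poch 1 n * poch (1 + a - b) n * poch (1 + a - c) n * poch (1 + a - d) n)).

(** Both 3F2 series have this form, with x = 1/2+a/2 or x = 1+a/2. *)
Definition rhs_term (a b c d x : C) (k : nat) : C :=
  poch c k * poch d k * poch (x - b) k /
  (poch 1 k * poch x k * poch (1 + a - b) k).

Lemma bigO_ext f g p q :
  (forall n, f n = g n) -> p = q -> bigO f p -> bigO g q.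
Proof.
  intros E -> [D [D0 H]]; exists D; split; auto; intros n; now rewrite <- E.
Qed.

Lemma bigO_rhs_term a b c d x : ~ nonpos_int x -> ~ nonpos_int (1 + a - b) ->
  bigO (rhs_term a b c d x) (-1 - Re (1 + a - c - d)).
Proof.
  intros Hx Hb.
  eapply bigO_ext; [| |exact
    (bigO_mult _ _ _ _ (bigO_poch c)
    (bigO_mult _ _ _ _ (bigO_poch d)
    (bigO_mult _ _ _ _ (bigO_poch (x - b))
    (bigO_mult _ _ _ _ (bigO_poch_inv x Hx) (bigO_poch_inv _ Hb)))))].
  - intros n; unfold rhs_term.
    assert (P1 := poch_neq0 _ n nonpos_1). assert (P2 := poch_neq0 _ n Hx).
    assert (P3 := poch_neq0 _ n Hb). field; auto.
  - unfold Re; simpl; ring.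
Qed.

Lemma bigO_lhs_term a b c d e : ~ nonpos_int e -> ~ nonpos_int (1 + a - b) ->
  ~ nonpos_int (1 + a - c) -> ~ nonpos_int (1 + a - d) ->
  bigO (lhs_term a b c d e) (- 3 - 2 * Re (a - b - c - d)).
Proof.
  intros He Hb Hc Hd.
  assert (E0 : bigO (fun _ => / e) 0).
  { exists (Cmod (/ e)); split; [apply Cmod_ge_0|]. intros n; rewrite pw_0; lra. }
  eapply bigO_ext; [| |exact
    (bigO_mult _ _ _ _ (bigO_poch a)
    (bigO_mult _ _ _ _ (bigO_poch b)
    (bigO_mult _ _ _ _ (bigO_poch c)
    (bigO_mult _ _ _ _ (bigO_poch d)
    (bigO_mult _ _ _ _ (bigO_linear e)
    (bigO_mult _ _ _ _ E0
    (bigO_mult _ _ _ _ (bigO_poch_inv _ Hb)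
    (bigO_mult _ _ _ _ (bigO_poch_inv _ Hc) (bigO_poch_inv _ Hd)))))))))].
  - intros n; unfold lhs_term.
    assert (P1 := poch_neq0 _ n nonpos_1). assert (P2 := poch_neq0 _ n Hb).
    assert (P3 := poch_neq0 _ n Hc). assert (P4 := poch_neq0 _ n Hd).
    assert (P5 := nonpos_neq0 _ He). field; auto 10.
  - unfold Re; simpl; ring.
Qed.

(** The quotient of successive terms is 1 + O(1/n), so a difference has order one less than the term
    itself; it is below -1 because the order p of the term is negative. *)
Lemma lhs_term_diff a b c d e : ~ nonpos_int e -> ~ nonpos_int (1 + a - b) ->
  ~ nonpos_int (1 + a - c) -> ~ nonpos_int (1 + a - d) ->
  (- 3 / 2 < Re (a - b - c - d))%R ->
  bsum (fun n => Cmod (lhs_term a b c d e (S n) - lhs_term a b c d e n)).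
Proof.
  intros He Hb Hc Hd Hr. set (u := lhs_term a b c d e).
  set (r := fun n : nat => (a + INR n) / (1 + INR n) *
    ((b + INR n) / (1 + a - b + INR n) * ((c + INR n) / (1 + a - c + INR n) *
    ((d + INR n) / (1 + a - d + INR n) * ((e + 1 + INR n) / (e + INR n)))))).
  assert (Hu : forall n, u (S n) = u n * r n).
  { intros n; unfold u, lhs_term, r. simpl poch; rewrite INR_S.
    assert (P1 := poch_neq0 _ n nonpos_1). assert (P2 := poch_neq0 _ n Hb).
    assert (P3 := poch_neq0 _ n Hc). assert (P4 := poch_neq0 _ n Hd).
    assert (P5 := nonpos_neq0 _ He).
    assert (Q1 := nonpos_shift_neq0 _ n nonpos_1).
    assert (Q2 := nonpos_shift_neq0 _ n Hb).
    assert (Q3 := nonpos_shift_neq0 _ n Hc). assert (Q4 := nonpos_shift_neq0 _ n Hd).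
    assert (Q5 := nonpos_shift_neq0 _ n He). field; auto 20. }
  assert (N : near1 r) 
    by (unfold r; do 4 (apply near1_mult; [apply near1_ratio|]); apply near1_ratio).
  destruct N as [D [N H]].
  destruct (bigO_lhs_term a b c d e He Hb Hc Hd) as [D' [D0' H']]. fold u in H'.
  set (p := (- 3 - 2 * Re (a - b - c - d))%R) in *.
  apply bsum_le with (fun n => (D' * Rabs D) * pw n (p + - (1)))%R N;
    auto using Cmod_ge_0.
  - intros n Hn. rewrite Hu. replace (u n * r n - u n) with (u n * (r n - 1)) by ring.
    rewrite Cmod_mult, pw_plus.
    replace (pw n (- (1))) with (/ (INR n + 1))%R.
    2:{ unfold pw. rewrite Rpower_Ropp, Rpower_1; auto. generalize (pos_INR n); lra. }
    replace (D' * Rabs D * (pw n p * / (INR n + 1)))%R with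
      ((D' * pw n p) * (Rabs D * / (INR n + 1)))%R by ring.
    apply Rmult_le_compat; auto using Cmod_ge_0.
    eapply Rle_trans; [apply H; easy|].
    apply Rmult_le_compat_r; [apply Rlt_le, inv_succ_bounds|apply Rle_abs].
  - intros n. apply Rmult_le_pos; [|apply Rlt_le, pw_pos].
    apply Rmult_le_pos; auto using Rabs_pos.
  - apply bsum_scal; [apply Rmult_le_pos; auto using Rabs_pos|].
    apply bsum_pw. unfold p; lra.
Qed.

Lemma lhs_cv a b c d e : ~ nonpos_int e -> ~ nonpos_int (1 + a - b) ->
  ~ nonpos_int (1 + a - c) -> ~ nonpos_int (1 + a - d) ->
  (- 3 / 2 < Re (a - b - c - d))%R ->
  exists l, Ccv (csum (fun n => (-1) ^ n * lhs_term a b c d e n)) l.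
Proof.
  intros. apply alternating_cv; [|now apply lhs_term_diff].
  eapply bigO_lim0; [|now apply bigO_lhs_term]. lra.
Qed.

Lemma rhs_cv a b c d x : ~ nonpos_int x -> ~ nonpos_int (1 + a - b) ->
  (0 < Re (1 + a - c - d))%R -> exists l, Ccv (csum (rhs_term a b c d x)) l.
Proof.
  intros. apply abs_cv. eapply bigO_bsum; [|now apply bigO_rhs_term]. lra.
Qed.

Lemma terminating_identity a b c d e m :
  ~ nonpos_int e -> ~ nonpos_int (1 + a) -> ~ nonpos_int (1 + a - b) ->
  ~ nonpos_int (1 + a - c) -> ~ nonpos_int (1 + a - d) ->
  ~ nonpos_int (1 + a - c - d) ->
  ~ nonpos_int (1 / 2 + 1 / 2 * a) -> ~ nonpos_int (1 + 1 / 2 * a) ->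
  csum (fun n => (-1) ^ n * lhs_term a b c d e n * wp_weight a m n) (S m) =
  poch (1 + a) m * poch (1 + a - c - d) m /
  (poch (1 + a - c) m * poch (1 + a - d) m) *
  (a / (2 * e) * csum (fun k => rhs_term a b c d (1 / 2 + 1 / 2 * a) k *
      saal_weight (1 + a - c - d) m k) (S m)
   + (1 - a / (2 * e)) * csum (fun k => rhs_term a b c d (1 + 1 / 2 * a) k *
      saal_weight (1 + a - c - d) m k) (S m)).
Proof.
  intros He Ha Hb Hc Hd Hs H1 H2.
  assert (W1 := well_poised_terminating (fun a n => a + 2 * INR n)
    (fun a => 1 / 2 + 1 / 2 * a) a b c d m).
  assert (W2 := well_poised_terminating (fun _ _ => 1)
    (fun a => 1 + 1 / 2 * a) a b c d m).
  cbv beta in W1, W2.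
  unfold rhs_term, saal_weight.
  set (P := poch (1 + a) m * poch (1 + a - c - d) m /
      (poch (1 + a - c) m * poch (1 + a - d) m)) in *.
  assert (E0 := nonpos_neq0 _ He).
  (* The factors a and 1 in front of P are the values W a 0 of the two instances. *)
  transitivity (/ (2 * e) * (a * P * csum (fun k => rhs_term a b c d (1 / 2 + 1 / 2 * a) k *
      saal_weight (1 + a - c - d) m k) (S m))
    + (1 - a / (2 * e)) * (1 * P * csum (fun k => rhs_term a b c d (1 + 1 / 2 * a) k *
      saal_weight (1 + a - c - d) m k) (S m))).
  2:{ unfold rhs_term, saal_weight; field; auto. }
  unfold rhs_term, saal_weight.
  rewrite <- W2; auto; [|intros; field|intros; field].
  replace (a * P) with ((a + 2 * INR 0) * P) by (simpl INR; ring).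
  rewrite <- W1; auto; [|intros; rewrite INR_S; ring|intros; field
    |intros; simpl INR; field].
  rewrite <- !csum_scal, <- csum_plus. apply csum_ext; intros n _.
  unfold lhs_term, wp_weight.
  assert (P1 := poch_neq0 _ n nonpos_1). assert (P2 := poch_neq0 _ n Hb).
  assert (P3 := poch_neq0 _ n Hc). assert (P4 := poch_neq0 _ n Hd).
  assert (P5 := poch_neq0 _ n (nonpos_shift _ m Ha)).
  (* The sign of the series at -1 cancels the sign in [wp_weight]. *)
  assert (S1 : (-1) ^ n * (-1) ^ n = 1).
  { rewrite <- Cpow_mult_l. replace (-1 * -1) with (RtoC 1) by ring. apply Cpow_1_l. }
  set (sg := (-1) ^ n) in *.
  transitivity (sg * sg * (poch a n * poch b n * poch c n * poch d n * (e + INR n) /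
    (e * (poch 1 n * poch (1 + a - b) n * poch (1 + a - c) n * poch (1 + a - d) n)) *
    (poch (- INR m) n / poch (1 + a + INR m) n))); [ring|].
  rewrite S1. field; auto 10.
Qed.

Lemma hyp_term_lhs a b c d e n : ~ nonpos_int e -> ~ nonpos_int (1 + a - b) ->
  ~ nonpos_int (1 + a - c) -> ~ nonpos_int (1 + a - d) ->
  hyp_term [a; b; c; d; 1 + e] [1 + a - b; 1 + a - c; 1 + a - d; e] (-1) n =
  (-1) ^ n * lhs_term a b c d e n.
Proof.
  intros He Hb Hc Hd. unfold hyp_term, lhs_term; simpl Cprod. rewrite <- poch_1.
  assert (E : poch (1 + e) n = poch e n * (e + INR n) / e).
  { change (poch e n * (e + INR n)) with (poch e (S n)). rewrite poch_Sl.
    replace (1 + e) with (e + 1) by ring. field. now apply nonpos_neq0. }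
  rewrite E.
  assert (P1 := poch_neq0 _ n nonpos_1). assert (P2 := poch_neq0 _ n Hb).
  assert (P3 := poch_neq0 _ n Hc). assert (P4 := poch_neq0 _ n Hd).
  assert (P5 := nonpos_neq0 _ He). assert (P6 := poch_neq0 _ n He).
  field; auto 10.
Qed.

Lemma hyp_term_rhs a b c d x y n : ~ nonpos_int x -> ~ nonpos_int (1 + a - b) ->
  y = x - b ->
  hyp_term [c; d; y] [x; 1 + a - b] 1 n = rhs_term a b c d x n.
Proof.
  intros Hx Hb ->. unfold hyp_term, rhs_term; simpl Cprod.
  rewrite <- poch_1, Cpow_1_l.
  assert (P1 := poch_neq0 _ n nonpos_1). assert (P2 := poch_neq0 _ n Hb).
  assert (P3 := poch_neq0 _ n Hx). field; auto.
Qed.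

Lemma hyp_of_cv p q z u l : (forall n, hyp_term p q z n = u n) -> Ccv (csum u) l ->
  hyp_cv p q z /\ hyp p q z = l.
Proof.
  intros E H. assert (H' : Ccv (csum (hyp_term p q z)) l).
  { apply Ccv_ext_loc with (2 := H) (N := O); intros; apply csum_ext; auto. }
  split; [exists l; now apply Ccv_is_series|now apply Ccv_CSeries].
Qed.

(** Gamma(1+a) and the symbols (1+a)_n in denominators require this. If 1+a = -n, then 1/2+a/2 =
    -n/2 for even n, and 1+a/2 = -(n-1)/2 for odd n. *)
Lemma half_shift_nonpos a : ~ nonpos_int (1 / 2 + 1 / 2 * a) ->
  ~ nonpos_int (1 + 1 / 2 * a) -> ~ nonpos_int (1 + a).
Proof.
  intros H1 H2 [n Hn].
  assert (Ea : a = - INR n - 1) by (rewrite <- Hn; ring).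
  destruct (Nat.Even_or_Odd n) as [[k ->]|[k ->]].
  - apply H1; exists k. rewrite Ea, mult_INR, RtoC_mult; simpl INR.
    rewrite RtoC_plus. field.
  - apply H2; exists k. rewrite Ea, plus_INR, mult_INR, RtoC_plus, RtoC_mult; simpl INR.
    rewrite RtoC_plus. field.
Qed.

Theorem theorem1 (a b c d e : C)
  (he : ~ nonpos_int e)
  (hb : ~ nonpos_int (1 + a - b))
  (hc : ~ nonpos_int (1 + a - c))
  (hd : ~ nonpos_int (1 + a - d))
  (ha1 : ~ nonpos_int (1 / 2 + 1 / 2 * a))
  (ha2 : ~ nonpos_int (1 + 1 / 2 * a))
  (hre : (Re (a - c - d) > Rmax (-1) (Re b - 3 / 2))%R) :
  hyp_cv [a; b; c; d; 1 + e] [1 + a - b; 1 + a - c; 1 + a - d; e] (-1) /\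
  hyp_cv [c; d; 1 / 2 + 1 / 2 * a - b] [1 / 2 + 1 / 2 * a; 1 + a - b] 1 /\
  hyp_cv [c; d; 1 + 1 / 2 * a - b] [1 + 1 / 2 * a; 1 + a - b] 1 /\
  hyp [a; b; c; d; 1 + e] [1 + a - b; 1 + a - c; 1 + a - d; e] (-1) =
    Gamma (1 + a - c) * Gamma (1 + a - d) /
      (Gamma (1 + a) * Gamma (1 + a - c - d)) *
    (a / (2 * e) *
       hyp [c; d; 1 / 2 + 1 / 2 * a - b] [1 / 2 + 1 / 2 * a; 1 + a - b] 1
     + (1 - a / (2 * e)) *
       hyp [c; d; 1 + 1 / 2 * a - b] [1 + 1 / 2 * a; 1 + a - b] 1).
Proof.
  assert (R1 := Rmax_l (-1) (Re b - 3 / 2)). assert (R2 := Rmax_r (-1) (Re b - 3 / 2)).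
  assert (S0 : (0 < Re (1 + a - c - d))%R).
  { replace (Re (1 + a - c - d)) with (1 + Re (a - c - d))%R
      by (unfold Re; simpl; ring). lra. }
  assert (S1 : (- 3 / 2 < Re (a - b - c - d))%R).
  { replace (Re (a - b - c - d)) with (Re (a - c - d) - Re b)%R
      by (unfold Re; simpl; ring). lra. }
  assert (ha := half_shift_nonpos a ha1 ha2).
  assert (hs := re_pos_not_nonpos _ S0).
  destruct (lhs_cv a b c d e) as [L HL]; auto.
  destruct (rhs_cv a b c d (1 / 2 + 1 / 2 * a)) as [X HX]; auto.
  destruct (rhs_cv a b c d (1 + 1 / 2 * a)) as [Y HY]; auto.
  destruct (hyp_of_cv [a; b; c; d; 1 + e] [1 + a - b; 1 + a - c; 1 + a - d; e] (-1)
    _ _ (fun n => hyp_term_lhs a b c d e n he hb hc hd) HL) as [C1 ->].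
  destruct (hyp_of_cv [c; d; 1 / 2 + 1 / 2 * a - b] [1 / 2 + 1 / 2 * a; 1 + a - b] 1
    _ _ (fun n => hyp_term_rhs a b c d _ _ n ha1 hb eq_refl) HX) as [C2 ->].
  destruct (hyp_of_cv [c; d; 1 + 1 / 2 * a - b] [1 + 1 / 2 * a; 1 + a - b] 1
    _ _ (fun n => hyp_term_rhs a b c d _ _ n ha2 hb eq_refl) HY) as [C3 ->].
  repeat split; auto.
  destruct (wp_weight_diff a ha) as [j0 Hj0].
  (* Both sides are limits of one sequence in m, the terminating sum. *)
  eapply Ccv_unique.
  - apply (regular_summation _ L (wp_weight a) j0 HL); auto.
    + intros m; unfold wp_weight, Cpow; simpl; field.
    + intros m; unfold wp_weight. rewrite poch_neg; unfold Cdiv; ring.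
    + intros n; now apply wp_weight_cv.
  - eapply Ccv_ext_loc with (N := O).
    + intros m _; symmetry; now apply terminating_identity.
    + apply Ccv_mult; [now apply Gamma_quotient_cv|].
      apply Ccv_plus; apply Ccv_scal; apply saal_sum_cv; auto using bigO_rhs_term.
Qed.
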